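(* Let $\alpha>0$, and let $\{(u_k,z_k,\lambda_k)\}$ be generated by the stochastic ADMM algorithm described in the context with the following parameters: $\theta_{-1}=0$, $\theta_0=1$, and $\theta_{k+1}>0$ determined by $\theta_{k+1}^2=\theta_k^2+\theta_{k+1}$ for $k\ge0$; $\rho_k=\rho\,\theta_k$, $\eta_k=\eta\,\theta_k$ for all $k$, where $\rho,\eta>0$ are constants with $\rho+\eta\le\alpha$ and $\eta(1-\mu)>\rho\mu$; and batch sizes satisfying $\sum_{k=0}^{\infty}\frac{1}{m_k}=\frac1M<\infty$ for a constant $M>0$. Suppose $f$ is $\alpha$-strongly convex with $L$-Lipschitz gradient, and the stochastic gradient is unbiased with variance bounded by $\varrho^2$ (both as specified in the context). Then for any $c>0$ with $c\ge 2\|\lambda^{\ast}\|$ and every $K\ge1$, $$\mathbb E\big[f(u_K)+g(z_K)-f(u^{\ast})-g(z^{\ast})\big]\le\frac{C_1}{K^2}\quad\text{and}\quad\mathbb E\big[\|u_K-z_K\|\big]\le\frac{2C_1}{cK^2},$$ where $$C_1=\frac{2\varrho^2\phi_{\theta_{2\kappa}}}{M}+2L\nu\,\theta_{2\kappa-1}^2+\frac{4(c^2+\|\lambda_0\|^2)}{\mu\rho},$$ with $$\nu=\max_{u,v\in U_{ad}}\|u-v\|^2,\qquad \kappa=\left\lceil\frac{L(1-\mu)}{\eta(1-\mu)-\rho\mu}\right\rceil,\qquad \phi_{t}=\frac{1-\mu}{\eta(1-\mu)-\mu\rho-t^{-1}L(1-\mu)}.$$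
   Context: Setting. $U$ is a real Hilbert space with inner product $\langle\cdot,\cdot\rangle$ and norm $\|\cdot\|$; $U_{ad}\subset U$ is nonempty, closed, convex and such that $\nu=\max_{u,v\in U_{ad}}\|u-v\|^2$ is finite. $(\Omega,\mathcal F,\mathbb P)$ is a probability space, $\xi:\Omega\to\Xi\subset\mathbb R^n$ a random vector, and $f(u)=\mathbb E[F(u,\xi)]$ is well defined and finite for every $u\in U$, where for each $\xi\in\Xi$ the functional $F(\cdot,\xi)$ is convex and Fréchet differentiable; $f$ is then convex and Fréchet differentiable. $\nabla F(u,\xi)$ denotes the gradient in $u$. $g:U\to(-\infty,+\infty]$ is proper, lower semicontinuous and convex. Assumption on $f$. For all $u,v\in U$, $f(u)+\langle\nabla f(u),v-u\rangle+\frac{\alpha}{2}\|v-u\|^2\le f(v)$ and $\|\nabla f(u)-\nabla f(v)\|\le L\|u-v\|$. Assumption on the stochastic gradient. For all $u\in U$, $\mathbb E[\nabla F(u,\xi)]=\nabla f(u)$ and $\mathbb E[\|\nabla F(u,\xi)-\nabla f(u)\|^2]\le\varrho^2$. Problem. $\min_{u\in U_{ad},\,z\in U} f(u)+g(z)$ subject to $u=z$. $(u^{\ast},z^{\ast})$ is an optimal solution (so $u^{\ast}=z^{\ast}\in U_{ad}$) and $\lambda^{\ast}\in U$ an associated optimal Lagrange multiplier, i.e. $g(z)-g(z^{\ast})+\langle\nabla f(u^{\ast}),u-u^{\ast}\rangle-\langle\lambda^{\ast},u-z\rangle\ge 0$ for all $u\in U_{ad}$, $z\in U$; such a triple is assumed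 to exist. Algorithm. Choose (deterministic) $(u_0,z_0)=(v_0,s_0)\in U_{ad}\times U$, initial multipliers $\psi_0=\lambda_0\in U$, and $\mu\in(0,1)$. For $k=0,1,2,\dots$: with parameters $\rho_k>0$, $\eta_k>0$, an integer $m_k>1$ and $\theta_k\ge 1$, generate realizations $\xi_{k,1},\dots,\xi_{k,m_k}$ of $\xi$ (all $\xi_{k,i}$, over all $k$ and $i$, are independent and distributed as $\xi$), set $G_k=\frac1{m_k}\sum_{i=1}^{m_k}\nabla F(v_k,\xi_{k,i})$, and compute $$ \begin{aligned} s_{k+1}&=\arg\min_{z\in U}\Big\{g(z)+\langle\lambda_k,z\rangle+\tfrac{\rho_k}{2}\|z-v_k\|^2\Big\},\\ v_{k+1}&=\arg\min_{u\in U_{ad}}\Big\{\langle G_k-\lambda_k,u\rangle+\tfrac{\rho_k}{2}\|u-s_{k+1}\|^2+\tfrac{\eta_k}{2}\|u-v_k\|^2\Big\},\\ \psi_{k+1}&=\psi_k-\mu\rho_k(v_{k+1}-s_{k+1}),\\ u_{k+1}&=(1-\theta_k^{-1})u_k+\theta_k^{-1}v_{k+1},\\ z_{k+1}&=(1-\theta_k^{-1})z_k+\theta_k^{-1}s_{k+1},\\ \lambda_{k+1}&=\psi_{k+1}-\mu\rho_k\theta_k(u_{k+1}-z_{k+1}). \end{aligned} $$ *)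

(* Defs.v *)
From HB Require Import structures.
From mathcomp Require Import all_boot all_order all_algebra.
From mathcomp Require Import sesquilinear.
From mathcomp Require Import all_classical all_reals all_analysis.
Set Implicit Arguments.
Unset Strict Implicit.
Unset Printing Implicit Defensive.
Import Order.TTheory GRing.Theory Num.Theory.
Import numFieldNormedType.Exports.

Local Open Scope classical_set_scope.
Local Open Scope ring_scope.

(* A real Hilbert space is a complete normed module U together with a dot
   product satisfying this predicate. *)
Definition norm_from_dot (R : realType) (U : normedModType R)
    (dot : {dot U for idfun}) : Prop :=
  forall x : U, `|x| ^+ 2 = dot x x.

(* Fréchet gradient: h is Fréchet differentiable at u and its differential is
   the functional represented by grad. *)
Definition is_gradient (R : realType) (U : normedModType R)
    (dot : {dot U for idfun}) (h : U -> R^o) (u grad : U) : Prop :=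
  is_diff u h (dot grad).

Definition proper_function (R : realType) (U : Type) (g : U -> \bar R) : Prop :=
  (forall z, g z != -oo%E) /\ (exists z, g z != +oo%E).

Definition econvex_function (R : realType) (U : lmodType R)
    (g : U -> \bar R) : Prop :=
  forall (x y : U) (t : R), 0 <= t <= 1 ->
    (g (t *: x + (1 - t) *: y)%R <= t%:E * g x + (1 - t)%:E * g y)%E.

Definition is_argmin (U : Type) (disp : Order.disp_t) (V : porderType disp)
    (D : set U) (J : U -> V) (x : U) : Prop :=
  D x /\ forall y, D y -> (J x <= J y)%O.

(* Finite-valued measurable functions into a normed module, and their pointwise
   limits.  The second notion agrees with Borel measurability when U is
   separable; for a general Hilbert space it is the measurability underlying
   the Bochner integral. *)
Definition simple_vector_fun (d : measure_display) (T : measurableType d)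
    (R : realType) (U : normedModType R) (s : T -> U) : Prop :=
  finite_set (range s) /\ forall y : U, measurable (s @^-1` [set y]).

(* D itself need not be measurable: the approximating functions are measurable
   on the whole of T, so that this is measurability for the trace on D of the
   sigma-algebra of T. *)
Definition strongly_measurable (d : measure_display) (T : measurableType d)
    (R : realType) (U : normedModType R) (D : set T) (X : T -> U) : Prop :=
  exists s : nat -> T -> U,
    (forall j, simple_vector_fun (s j)) /\
    (forall x, D x -> s j x @[j --> \oo] --> X x).

Definition simple_expectation (d : measure_display) (T : measurableType d)
    (R : realType) (U : normedModType R) (P : probability T R)
    (s : T -> U) : U :=
  \sum_(y \in range s) fine (P (s @^-1` [set y])) *: y.

(* e is the Bochner integral of X under P. *)
Definition is_bochner_expectation (d : measure_display) (T : measurableType d)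
    (R : realType) (U : normedModType R) (P : probability T R)
    (X : T -> U) (e : U) : Prop :=
  strongly_measurable setT X /\
  exists s : nat -> T -> U,
    [/\ forall j, simple_vector_fun (s j),
        (\int[P]_w (`|X w - s j w|)%:E)%E @[j --> \oo] --> (0 : \bar R)%E
      & simple_expectation P (s j) @[j --> \oo] --> e].

(* Mutual independence of the variables X i, i ranging over D. *)
Definition mutually_independent (d d' : measure_display)
    (T : measurableType d) (T' : measurableType d') (R : realType)
    (P : probability T R) (I : choiceType) (D : set I)
    (X : I -> {mfun T >-> T'}) : Prop :=
  forall (J : seq I) (B : I -> set T'),
    uniq J -> (forall i, i \in J -> D i) ->
    (forall i, i \in J -> measurable (B i)) ->
    P (\bigcap_(i in [set` J]) (X i @^-1` B i)) =
    (\prod_(i <- J) P (X i @^-1` B i))%E.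

(* xis k i, for i < m k, are the samples drawn at iteration k (numbered from 0):
   independent over all k and i, distributed as xi, with values in Xi. *)
Definition iid_batches (d d' : measure_display)
    (Omega : measurableType d) (S : measurableType d') (R : realType)
    (P : probability Omega R) (Xi : set S) (xi : {mfun Omega >-> S})
    (m : nat -> nat) (xis : nat -> nat -> {mfun Omega >-> S}) : Prop :=
  [/\ forall k i w, (i < m k)%N -> Xi (xis k i w),
      forall k i B, (i < m k)%N -> measurable B ->
        distribution P (xis k i) B = distribution P xi B
    & mutually_independent P [set p : nat * nat | (p.2 < m p.1)%N]
        (fun p => xis p.1 p.2)].

Definition optimal_solution (R : realType) (U : normedModType R)
    (Uad : set U) (f : U -> R) (g : U -> \bar R) (u z : U) : Prop :=
  [/\ Uad u, u = z, g z \is a fin_num &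
      forall u' z', Uad u' -> u' = z' ->
        ((f u)%:E + g z <= (f u')%:E + g z')%E].

Definition optimal_multiplier (R : realType) (U : normedModType R)
    (dot : {dot U for idfun}) (Uad : set U) (gradf : U -> U) (g : U -> \bar R)
    (ustar zstar lamstar : U) : Prop :=
  forall u z, Uad u ->
    (0 <= g z - g zstar
          + (dot (gradf ustar) (u - ustar))%:E - (dot lamstar (u - z))%:E)%E.

(* One trajectory of the stochastic ADMM, driven by the samples x k i, i < m k. *)
Record sadmm_iterates (R : realType) (U : normedModType R)
    (dot : {dot U for idfun}) (S : Type) (Uad : set U)
    (g : U -> \bar R) (gradF : U -> S -> U)
    (mu : R) (rho eta theta : nat -> R) (m : nat -> nat) (x : nat -> nat -> S)
    (u0 z0 lam0 : U) (u z v s psi lam : nat -> U) : Prop := SadmmIterates {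
  sadmm_u0 : u 0%N = u0;
  sadmm_z0 : z 0%N = z0;
  sadmm_v0 : v 0%N = u0;
  sadmm_s0 : s 0%N = z0;
  sadmm_psi0 : psi 0%N = lam0;
  sadmm_lam0 : lam 0%N = lam0;
  sadmm_s : forall k,
    is_argmin setT
      (fun y => g y
                + (dot (lam k) y + rho k / 2 * `|y - v k| ^+ 2)%:E)%E
      (s k.+1);
  sadmm_v : forall k,
    let G := (m k)%:R^-1 *: \sum_(i < m k) gradF (v k) (x k i) in
    is_argmin Uad
      (fun y => dot (G - lam k) y + rho k / 2 * `|y - s k.+1| ^+ 2
                + eta k / 2 * `|y - v k| ^+ 2)
      (v k.+1);
  sadmm_psi : forall k,
    psi k.+1 = psi k - (mu * rho k) *: (v k.+1 - s k.+1);
  sadmm_u : forall k,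
    u k.+1 = (1 - (theta k)^-1) *: u k + (theta k)^-1 *: v k.+1;
  sadmm_z : forall k,
    z k.+1 = (1 - (theta k)^-1) *: z k + (theta k)^-1 *: s k.+1;
  sadmm_lam : forall k,
    lam k.+1 = psi k.+1 - (mu * rho k * theta k) *: (u k.+1 - z k.+1)
}.

(* max ||u - v||^2 over Uad, as a supremum since a bounded closed convex set of
   infinite dimension need not attain its diameter. *)
Definition sqdiameter (R : realType) (U : normedModType R) (Uad : set U) : R :=
  sup [set `|p.1 - p.2| ^+ 2 | p in Uad `*` Uad].

Definition sadmm_kappa (R : realType) (L mu rho eta : R) : int :=
  Num.ceil (L * (1 - mu) / (eta * (1 - mu) - rho * mu)).

Definition sadmm_phi (R : realType) (L mu rho eta t : R) : R :=
  (1 - mu) / (eta * (1 - mu) - mu * rho - t^-1 * L * (1 - mu)).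

(* theta is indexed by int because theta (-1) occurs. *)
Definition sadmm_C1 (R : realType) (theta : int -> R)
    (L mu rho eta varrho M nu c normlam0 : R) : R :=
  let kappa := sadmm_kappa L mu rho eta in
  2 * varrho ^+ 2 * sadmm_phi L mu rho eta (theta (2 * kappa)) / M
  + 2 * L * nu * theta (2 * kappa - 1) ^+ 2
  + 4 * (c ^+ 2 + normlam0 ^+ 2) / (mu * rho).

(* Main.v *)
Require Import Defs.
From HB Require Import structures.
From mathcomp Require Import all_boot all_order all_algebra.
From mathcomp Require Import sesquilinear ring lra.
From mathcomp Require Import all_classical all_reals all_analysis.
From mathcomp Require Import measurable_realfun.
Set Implicit Arguments.
Unset Strict Implicit.
Unset Printing Implicit Defensive.
Import Order.TTheory GRing.Theory Num.Theory.
Import numFieldNormedType.Exports.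
Local Open Scope classical_set_scope.
Local Open Scope ring_scope.

(** With D_k = theta_{k-1}^2 (u_k - z_k), the multiplier updates telescope to
    psi_k = lambda_0 - mu rho D_k and lambda_k = lambda_0 - 2 mu rho D_k.
    Multiplying the one-step inequality of the two proximal problems by theta_k
    therefore makes every deterministic term telescope, because
    theta_k^2 - theta_k = theta_{k-1}^2 and rho + eta <= alpha; the quadratic
    -mu rho |D_K|^2 left over pays for c |D_K|.  For k >= 2 kappa the proximal
    term eta_k absorbs the descent-lemma error L/2 |v_{k+1} - v_k|^2; before
    that it is bounded by L nu / 2.

    What remains is the noise - theta_k <delta_k, v_k - u*> + phi/2 |delta_k|^2,
    where delta_k = G_k - grad f(v_k).  Completing the square turns its
    expectation into that of |Y + sum_i Phi(v_k, xi_{k,i})|^2 with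
    Phi(v, xi) = grad F(v, xi) - grad f(v), which grows by at most varrho^2 with
    each sample: E |Y + Phi(V, xi)|^2 <= E |Y|^2 + varrho^2 as soon as xi is
    independent of (Y, V).  The latter follows by expanding the square on the
    level sets of countably valued (Y, V) and passes to the limit by Fatou's lemma, so no
    conditional expectation is needed.  Measurability of the iterates comes from
    the argmins being Lipschitz in their data and from grad F(., xi) being
    continuous, F(., xi) being convex and Frechet differentiable. *)

(** * Convex analysis in an inner product space *)

Section dot_product.
Context {R : realType} {U : normedModType R} (dot : {dot U for idfun}).
Hypothesis hilbert : norm_from_dot dot.
Implicit Types x y z : U.

Lemma dot_sym x y : dot x y = dot y x.
Proof. by rewrite hermC /= expr0 mul1r. Qed.

Lemma dotDl z x y : dot (x + y) z = dot x z + dot y z.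
Proof. by rewrite linearDl. Qed.

Lemma dotBl z x y : dot (x - y) z = dot x z - dot y z.
Proof. by rewrite linearBl. Qed.

Lemma dotNl z x : dot (- x) z = - dot x z.
Proof. by rewrite linearNl. Qed.

Lemma dotZl z a x : dot (a *: x) z = a * dot x z.
Proof. by rewrite linearZl_LR. Qed.

Lemma dotDr z x y : dot z (x + y) = dot z x + dot z y.
Proof. by rewrite dot_sym dotDl !(dot_sym z). Qed.

Lemma dotBr z x y : dot z (x - y) = dot z x - dot z y.
Proof. by rewrite dot_sym dotBl !(dot_sym z). Qed.

Lemma dotNr z x : dot z (- x) = - dot z x.
Proof. by rewrite dot_sym dotNl !(dot_sym z). Qed.

Lemma dotZr z a x : dot z (a *: x) = a * dot z x.
Proof. by rewrite dot_sym dotZl !(dot_sym z). Qed.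

Definition dotE := (dotDl, dotDr, dotNl, dotNr, dotZl, dotZr).

Lemma dot0l z : dot 0 z = 0.
Proof. by rewrite -(scale0r z) dotZl mul0r. Qed.

Lemma dot0r z : dot z 0 = 0.
Proof. by rewrite dot_sym dot0l. Qed.

Lemma normD_sq x y : `|x + y| ^+ 2 = `|x| ^+ 2 + 2 * dot x y + `|y| ^+ 2.
Proof. by rewrite !hilbert !dotE (dot_sym y x); lra. Qed.

Lemma normB_sq x y : `|x - y| ^+ 2 = `|x| ^+ 2 - 2 * dot x y + `|y| ^+ 2.
Proof. by rewrite !hilbert !dotE (dot_sym y x); lra. Qed.

Lemma normZ_sq a x : `|a *: x| ^+ 2 = a ^+ 2 * `|x| ^+ 2.
Proof. by rewrite normrZ exprMn real_normK ?num_real. Qed.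

Lemma Cauchy_Schwarz_dot x y : dot x y <= `|x| * `|y|.
Proof.
have [->|x0] := eqVneq x 0; first by rewrite dot0l normr0 mul0r.
have [->|y0] := eqVneq y 0; first by rewrite dot0r normr0 mulr0.
have nx : 0 < `|x| by rewrite normr_gt0.
have ny : 0 < `|y| by rewrite normr_gt0.
have := sqr_ge0 `|(`|y| *: x - `|x| *: y)|.
rewrite normB_sq !normZ_sq !dotE => H.
have : 0 <= (2 * (`|x| * `|y|)) * (`|x| * `|y| - dot x y).
  apply: le_trans H _; rewrite le_eqVlt; apply/orP; left; apply/eqP; ring.
by rewrite pmulr_rge0 ?subr_ge0 ?mulr_gt0.
Qed.

Lemma Cauchy_Schwarz_dotN x y : - (`|x| * `|y|) <= dot x y.
Proof.
by have := Cauchy_Schwarz_dot (- x) y; rewrite dotNl normrN lerNl.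
Qed.

(* [t] is free so that it can be matched with the dual step length [mu]. *)
Lemma norm_convex_comb_sq (t : R) x y :
  t * (1 - t) * `|x - y| ^+ 2 <= t * `|x| ^+ 2 + (1 - t) * `|y| ^+ 2.
Proof.
have : 0 <= `|t *: x + (1 - t) *: y| ^+ 2 by rewrite sqr_ge0.
rewrite (normD_sq (_ *: x)) !normZ_sq !dotE normB_sq => H.
rewrite -subr_ge0; apply: le_trans H _.
rewrite le_eqVlt; apply/orP; left; apply/eqP; ring.
Qed.

Lemma young_dot (a : R) x y : 0 < a ->
  - dot x y <= a^-1 / 2 * `|x| ^+ 2 + a / 2 * `|y| ^+ 2.
Proof.
move=> a0.
have : 0 <= `|x + a *: y| ^+ 2 by rewrite sqr_ge0.
rewrite normD_sq normZ_sq !dotE => H.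
have : 0 <= a^-1 / 2 * (`|x| ^+ 2 + 2 * (a * dot x y) + a ^+ 2 * `|y| ^+ 2).
  by rewrite mulr_ge0// divr_ge0 ?invr_ge0 ?ltW.
move=> H1; rewrite -subr_ge0 opprK; apply: le_trans H1 _.
by rewrite le_eqVlt; apply/orP; left; apply/eqP; field; rewrite gt_eqF.
Qed.

End dot_product.

Section real_lemmas.
Context {R : realType}.

Lemma le_of_forall_small (a b c : R) :
  (forall t, 0 < t < 1 -> a <= b + t * c) -> a <= b.
Proof.
move=> H; apply/ler_addgt0Pr => e e0.
pose t := Num.min (1 / 2) (e / (`|c| + 1)).
have c1 : 0 < `|c| + 1 by rewrite ltr_wpDl.
have t0 : 0 < t by rewrite /t lt_min divr_gt0// divr_gt0.
have t1 : t < 1 by rewrite /t gt_min; apply/orP; left; lra.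
apply: le_trans (H t _) _; first by rewrite t0.
rewrite lerD2l; apply: (@le_trans _ _ (t * (`|c| + 1))).
  by rewrite ler_pM2l//; apply: le_trans (ler_norm c) _; rewrite lerDl.
by rewrite -ler_pdivlMr// /t ge_min lexx orbT.
Qed.

End real_lemmas.

Section gradients.
Context {R : realType} {U : normedModType R} (dot : {dot U for idfun}).
Hypothesis hilbert : norm_from_dot dot.
Implicit Types (h : U -> R) (u v : U).

Lemma gradient_expansion h u grad : is_gradient dot h u grad ->
  forall e : R, 0 < e -> exists2 r : R, 0 < r &
    forall y, `|y| <= r -> `|h (u + y) - h u - dot grad y| <= e * `|y|.
Proof.
case=> dh dhE e e0.
have /eqaddoP/(_ e e0) := diff_locally dh.
move=> /nbhs_ballP[r /= r0 H].
exists (r / 2) => [|y yr]; first by rewrite divr_gt0.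
have := H y; rewrite -ball_normE /= sub0r normrN dhE !fctE /= [y + u]addrC opprD addrA; apply.
by apply: le_lt_trans yr _; rewrite ltr_pdivrMr// ltr_pMr// ltr1n.
Qed.

Lemma convex_function_comb h x y (t : R) : convex_function [set: U] h ->
  0 <= t <= 1 -> h (t *: x + (1 - t) *: y) <= t * h x + (1 - t) * h y.
Proof.
move=> ch /andP[t0 t1].
by have := ch (Itv01 t0 t1) x y; rewrite !inE => /(_ I I); rewrite convRE.
Qed.

Lemma convex_set_comb (A : set U) x y (t : R) : convex_set A ->
  0 <= t <= 1 -> A x -> A y -> A (t *: x + (1 - t) *: y).
Proof.
move=> cA /andP[t0 t1] Ax Ay.
by have := cA x y (Itv01 t0 t1); rewrite !inE => /(_ Ax Ay).
Qed.

Lemma convex_gradient_le h u v grad : convex_function [set: U] h ->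
  is_gradient dot h u grad -> h u + dot grad (v - u) <= h v.
Proof.
move=> ch hu; apply: (@le_of_forall_small _ _ _ `|v - u|) => e /andP[e0 _].
have [r r0 H] := gradient_expansion hu e0.
pose t := Num.min 1 (r / (`|v - u| + 1)).
have n1 : 0 < `|v - u| + 1 by rewrite ltr_wpDl.
have t0 : 0 < t by rewrite /t lt_min ltr01 divr_gt0.
have t1 : t <= 1 by rewrite /t ge_min lexx.
have tr : `|t *: (v - u)| <= r.
  rewrite normrZ gtr0_norm//; apply: (@le_trans _ _ (t * (`|v - u| + 1))).
    by rewrite ler_pM2l// lerDl.
  by rewrite -ler_pdivlMr// /t ge_min lexx orbT.
have := H _ tr; rewrite ler_norml => /andP[+ _].
rewrite normrZ (gtr0_norm t0) (dotZr dot).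
have -> : u + t *: (v - u) = t *: v + (1 - t) *: u.
  by rewrite scalerBr scalerBl scale1r addrCA addrC -addrA [- _ + _]addrC addrA.
have t01 : 0 <= t <= 1 by rewrite ltW.
have := convex_function_comb v u ch t01 => Hc Hl.
rewrite -(ler_pM2l t0).
move: Hc Hl; set a := h _; set b := h v; set c := h u; set D := dot _ _.
set N := `|_|; nra.
Qed.

Lemma convex_gradient_continuous h (grad : U -> U) :
  convex_function [set: U] h -> (forall u, is_gradient dot h u (grad u)) ->
  continuous grad.
Proof.
move=> ch hg u; apply/cvgrPdist_le => /= e e0.
have e20 : 0 < e / 2 by rewrite divr_gt0.
have [r r0 H] := gradient_expansion (hg u) e20.
pose r' := r / 2.
have r'0 : 0 < r' by rewrite divr_gt0.
have rr : r' + r' = r by rewrite /r' -splitr.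
near=> v.
have vu : `|v - u| <= r'.
  by rewrite distrC; near: v; apply: cvgr_dist_le.
set D := grad u - grad v.
have [->|D0] := eqVneq D 0; first by rewrite normr0 ltW.
have nD : 0 < `|D| by rewrite normr_gt0.
pose y := - (r' / `|D|) *: D.
have ny : `|y| = r'.
  by rewrite /y normrZ normrN gtr0_norm ?divr_gt0// divfK// gt_eqF.
have vyu : `|(v - u) + y| <= r.
  by apply: le_trans (ler_normD _ _) _; rewrite ny -rr lerD2r.
have := H _ vyu; rewrite ler_norml => /andP[_].
have := convex_gradient_le (v + y) ch (hg v).
have := convex_gradient_le v ch (hg u).
rewrite addrA (addrCA u) subrr addr0 (addrC v y) addrK => H1 H2 H3.
have : - dot D y <= e * r'.
  rewrite /D (dotBl dot); move: H1 H2 H3; rewrite (dotDr dot) => H1 H2 H3.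
  have : e / 2 * `|v - u + y| <= e * r'.
    by rewrite -mulrA ler_pM2l// mulrC ler_pdivrMr// mulr_natr mulr2n rr.
  move: H1 H2 H3; rewrite [y + v]addrC; lra.
rewrite /y (dotZr dot) mulNr opprK -hilbert expr2 mulrA divfK ?gt_eqF//.
by rewrite mulrC ler_pM2r.
Unshelve. all: by end_near. Qed.

Lemma descent_lemma h (grad : U -> U) (L : R) : 0 <= L ->
  (forall u v, h u + dot (grad u) (v - u) <= h v) ->
  (forall u v, `|grad u - grad v| <= L * `|u - v|) ->
  forall a b, h b <= h a + dot (grad a) (b - a) + L / 2 * `|b - a| ^+ 2.
Proof.
move=> L0 hc hL a b; set y := b - a.
apply: (@le_of_forall_small _ _ _ (L / 2 * `|y| ^+ 2)) => t /andP[t0 _].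
pose n := (Num.truncn t^-1).+1.
have n0 : 0 < n%:R :> R by rewrite ltr0n.
have nt : n%:R^-1 <= t.
  rewrite -[leRHS]invrK lef_pV2 ?posrE ?invr_gt0//.
  by apply/ltW; rewrite /n; apply: truncnS_gt.
have nn : n%:R * n%:R^-1 = 1 :> R by rewrite divff// gt_eqF.
move: (n%:R^-1) n0 nt nn => p n0 pt np.
have p0 : 0 < p by rewrite -(pmulr_rgt0 _ n0) np.
suff H (i : nat) : h (a + (i%:R * p) *: y) <= h a + i%:R * p * dot (grad a) y
    + L * `|y| ^+ 2 * p ^+ 2 * (i%:R * (i%:R + 1)) / 2.
  have := H n; rewrite np scale1r mul1r addrC subrK => /le_trans; apply.
  rewrite -!addrA !lerD2l.
  have -> : L * `|y| ^+ 2 * p ^+ 2 * (n%:R * (n%:R + 1)) / 2 =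
     L / 2 * `|y| ^+ 2 * (n%:R * p) * (n%:R * p + p) by field.
  rewrite np mulr1 mulrDr mulr1 lerD2l mulrC ler_wpM2r//.
  by rewrite mulr_ge0 ?divr_ge0 ?sqr_ge0.
elim: i => [|i IH]; first by rewrite !(mul0r,mulr0) scale0r !addr0.
set x1 := a + (i.+1%:R * p) *: y; set x0 := a + (i%:R * p) *: y in IH.
have x01 : x0 - x1 = - (p *: y).
  rewrite /x0 /x1 opprD addrACA subrr add0r -scalerBl.
  by rewrite -natr1 mulrDl mul1r opprD addrA subrr add0r scaleNr.
have := hc x1 x0; rewrite x01 (dotNr dot) (dotZr dot) => H1.
have x1a : `|grad x1 - grad a| <= L * (i.+1%:R * p * `|y|).
  apply: le_trans (hL _ _) _; rewrite ler_wpM2l// /x1 addrC addKr normrZ.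
  by rewrite ger0_norm// mulr_ge0 // ltW.
have := Cauchy_Schwarz_dot hilbert (grad x1 - grad a) y.
rewrite (dotBl dot) => H2.
have H3 : dot (grad x1) y - dot (grad a) y <= L * (i.+1%:R * p * `|y|) * `|y|.
  by apply: le_trans H2 _; rewrite ler_wpM2r.
have H4 := ler_wpM2l (ltW p0) H3.
rewrite -natr1 in H4 *.
move: IH H1 H4; set Y := `|y|; set I := i%:R; set A := dot (grad a) y.
set B := dot (grad x1) y => IH H1 H4.
rewrite -subr_ge0.
apply: (@le_trans _ _ ((h a + I * p * A + L * Y ^+ 2 * p ^+ 2 * (I * (I + 1)) / 2 - h x0)
   + (h x0 - (h x1 - p * B)) + (p * (L * ((I + 1) * p * Y) * Y) - p * (B - A)))).
  apply: addr_ge0; first apply: addr_ge0; rewrite subr_ge0.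
  - exact: IH.
  - exact: H1.
  - exact: H4.
by rewrite le_eqVlt; apply/orP; left; apply/eqP; field.
Qed.

(* Expanding [|y_t - v|^2] along the segment from the minimizer to [y] and
   dividing by [t] gains the full modulus [r1 + r2] in the limit. *)
Lemma quadratic_argmin_le (A : set U) (c : U -> R) (r1 r2 : R) (v1 v2 s y : U) :
  (forall t, 0 < t < 1 -> A (t *: y + (1 - t) *: s)) ->
  (forall t, 0 < t < 1 ->
    c (t *: y + (1 - t) *: s) <= t * c y + (1 - t) * c s) ->
  (forall x, A x -> c s + r1 / 2 * `|s - v1| ^+ 2 + r2 / 2 * `|s - v2| ^+ 2
     <= c x + r1 / 2 * `|x - v1| ^+ 2 + r2 / 2 * `|x - v2| ^+ 2) ->
  c s + r1 / 2 * `|s - v1| ^+ 2 + r2 / 2 * `|s - v2| ^+ 2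
    + (r1 + r2) / 2 * `|y - s| ^+ 2
  <= c y + r1 / 2 * `|y - v1| ^+ 2 + r2 / 2 * `|y - v2| ^+ 2.
Proof.
move=> hA hc hs.
apply: (@le_of_forall_small _ _ _ ((r1 + r2) / 2 * `|y - s| ^+ 2)) => t t01.
have E v : `|t *: y + (1 - t) *: s - v| ^+ 2 =
  t * `|y - v| ^+ 2 + (1 - t) * `|s - v| ^+ 2 - t * (1 - t) * `|y - s| ^+ 2.
  rewrite !hilbert !(dotE dot) (dot_sym dot s y) (dot_sym dot v y).
  rewrite (dot_sym dot v s); ring.
have := hs _ (hA _ t01); rewrite !E.
have := hc _ t01; have /andP[t0 t1] := t01.
move: (c _) => C.
move: (c s) (c y) => a b.
move: (`|y - v1| ^+ 2) (`|s - v1| ^+ 2) (`|y - s| ^+ 2).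
move: (`|y - v2| ^+ 2) (`|s - v2| ^+ 2) => q1 q2 q3 q4 q5 H1 H2.
rewrite -(ler_pM2l t0) -subr_ge0.
have := lerD H2 H1.
rewrite -subr_ge0 => /le_trans; apply.
by rewrite le_eqVlt; apply/orP; left; apply/eqP; field.
Qed.

Lemma quadratic_argmin_nonexpansive (r1 r2 c c' : R) (b b' v1 v1' v2 v2' s s' : U) :
  0 < r1 + r2 ->
  c + dot b s + r1 / 2 * `|s - v1| ^+ 2 + r2 / 2 * `|s - v2| ^+ 2
    + (r1 + r2) / 2 * `|s' - s| ^+ 2
  <= c' + dot b s' + r1 / 2 * `|s' - v1| ^+ 2 + r2 / 2 * `|s' - v2| ^+ 2 ->
  c' + dot b' s' + r1 / 2 * `|s' - v1'| ^+ 2 + r2 / 2 * `|s' - v2'| ^+ 2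
    + (r1 + r2) / 2 * `|s - s'| ^+ 2
  <= c + dot b' s + r1 / 2 * `|s - v1'| ^+ 2 + r2 / 2 * `|s - v2'| ^+ 2 ->
  `|s - s'| <= (r1 + r2)^-1 *
    `|(r1 *: v1 + r2 *: v2 - b) - (r1 *: v1' + r2 *: v2' - b')|.
Proof.
move=> r0; rewrite (distrC s' s) => H1 H2.
set p := _ - (_ - b').
have H : (r1 + r2) * `|s - s'| ^+ 2 <= dot (s - s') p.
  have := lerD H1 H2; rewrite -subr_ge0 => H3; rewrite -subr_ge0.
  apply: le_trans H3 _.
  rewrite le_eqVlt; apply/orP; left; apply/eqP.
  rewrite /p !hilbert !(dotE dot).
  rewrite ?(dot_sym dot s' s) ?(dot_sym dot v1 s) ?(dot_sym dot v2 s) ?(dot_sym dot v1' s).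
  rewrite ?(dot_sym dot v2' s) ?(dot_sym dot v1 s') ?(dot_sym dot v2 s') ?(dot_sym dot v1' s').
  rewrite ?(dot_sym dot v2' s') ?(dot_sym dot b s) ?(dot_sym dot b' s) ?(dot_sym dot b s').
  by rewrite ?(dot_sym dot b' s'); field.
case: (boolP (s == s')) => [/eqP|] ss'.
  by rewrite ss' subrr normr0 mulr_ge0// invr_ge0 ltW.
have n0 : 0 < `|s - s'| by rewrite normr_gt0 subr_eq0.
have := le_trans H (Cauchy_Schwarz_dot hilbert _ _).
rewrite expr2 mulrCA ler_pM2l// => H3.
by rewrite mulrC ler_pdivlMr// mulrC.
Qed.

End gradients.

(** * Step sizes and proximal steps *)

Section theta_sequence.
Context {R : realType} (th : nat -> R).
Hypothesis th0 : th 0%N = 1.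
Hypothesis thS : forall k, 0 < th k.+1 /\ th k.+1 ^+ 2 = th k ^+ 2 + th k.+1.

(* [theta_sq_pred th k] is theta_{k-1}^2, with the convention theta_{-1} = 0. *)
Definition theta_sq_pred (k : nat) : R := if k is j.+1 then th j ^+ 2 else 0.

Lemma theta_sqE k : th k ^+ 2 = theta_sq_pred k + th k.
Proof. by case: k => [|k] /=; [rewrite th0; ring | rewrite (thS k).2]. Qed.

Lemma theta_ge k : 1 + k%:R / 2 <= th k.
Proof.
elim: k => [|k IH]; first by rewrite th0; lra.
have k0 : 0 <= k%:R :> R by [].
have [t0 tE] := thS k; rewrite -natr1.
move: IH tE t0; set s := th k; set t := th k.+1; set i := k%:R => IH tE t0.
have t1 : 1 < t by rewrite ltNge; apply/negP => t1; nra.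
have : s + 1 / 2 <= t by rewrite leNgt; apply/negP => ts; nra.
lra.
Qed.

Lemma theta_ge1 k : 1 <= th k.
Proof.
by apply: le_trans (theta_ge k); rewrite lerDl divr_ge0.
Qed.

Lemma theta_sq_pred_ge0 k : 0 <= theta_sq_pred k.
Proof. by case: k => [|k] //=; rewrite sqr_ge0. Qed.

Lemma theta_sq_pred_mono k l : (k <= l)%N -> theta_sq_pred k <= theta_sq_pred l.
Proof.
move=> /subnK <-; elim: (l - k)%N => [//|n IH]; apply: (le_trans IH).
rewrite addSn /= theta_sqE lerDl; exact: le_trans ler01 (theta_ge1 _).
Qed.

Lemma theta_mono k l : (k <= l)%N -> th k <= th l.
Proof.
move=> kl; have : th k ^+ 2 <= th l ^+ 2 by apply: (@theta_sq_pred_mono k.+1 l.+1).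
by rewrite ler_sqr// nnegrE (le_trans ler01 (theta_ge1 _)).
Qed.

Lemma theta_sq_pred_ge k : (0 < k)%N -> k%:R ^+ 2 / 4 <= theta_sq_pred k.
Proof.
case: k => [//|k _] /=; have := theta_ge k; rewrite -[k.+1%:R]natr1.
have : 0 <= k%:R :> R by [].
move: (k%:R) (th k) => i t i0 it.
have : ((i + 1) / 2) ^+ 2 <= t ^+ 2 by rewrite ler_sqr ?nnegrE; lra.
by rewrite expr_div_n; lra.
Qed.

Lemma phi_bounds (L mu rho eta : R) (N : nat) :
  0 <= L -> 0 < mu < 1 -> rho * mu < eta * (1 - mu) ->
  L * (1 - mu) / (eta * (1 - mu) - rho * mu) <= N%:R / 2 ->
  let phi := sadmm_phi L mu rho eta (th N) in
  [/\ 0 < phi, 1 <= phi * (eta - rho * (mu / (1 - mu)))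
    & forall k, (N <= k)%N ->
      th k <= phi * ((eta - rho * (mu / (1 - mu))) * th k - L)].
Proof.
move=> L0 /andP[mu0 mu1] emu LN phi.
set a := 1 - mu in emu LN phi *.
have a0 : 0 < a by rewrite subr_gt0.
set D := eta * a - rho * mu in LN *.
have D0 : 0 < D by rewrite subr_gt0.
have eE : eta - rho * (mu / a) = D / a by rewrite /D; field; rewrite gt_eqF.
have tN k : 0 < th k by apply: lt_le_trans (theta_ge1 k).
have LtD : L * a < th N * D.
  rewrite -ltr_pdivrMr//; apply: le_lt_trans LN _.
  by apply: lt_le_trans (theta_ge N); rewrite ltrDr.
have q0 : 0 < D - (th N)^-1 * L * a.
  by rewrite subr_gt0 -mulrA ltr_pdivrMl.
have phiE : phi = a / (D - (th N)^-1 * L * a) by rewrite /phi /sadmm_phi /D (mulrC mu).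
have tn : th N != 0 by rewrite gt_eqF.
have an : a != 0 by rewrite gt_eqF.
rewrite phiE eE; split.
- exact: divr_gt0.
- rewrite mulrAC mulrCA mulfV// mulr1 ler_pdivlMr// mul1r gerBl.
  by apply: mulr_ge0 (ltW a0); apply: mulr_ge0 L0; rewrite invr_ge0 ltW.
- move=> k Nk; rewrite mulrAC ler_pdivlMr// -subr_ge0.
  have -> : a * (D / a * th k - L) - th k * (D - (th N)^-1 * L * a) =
      L * a * ((th k - th N) / th N) by field; rewrite tn an.
  apply: mulr_ge0; first by rewrite mulr_ge0// ltW.
  by rewrite divr_ge0 ?subr_ge0 ?theta_mono// ltW.
Qed.

End theta_sequence.

Section argmin.
Context {R : realType} {U : normedModType R} (dot : {dot U for idfun}).
Hypothesis hilbert : norm_from_dot dot.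

Lemma argmin_convex_set (A : set U) (b s v : U) (r1 r2 : R) (v1 v2 : U) :
  convex_set A ->
  is_argmin A (fun y => dot b y + r1 / 2 * `|y - v1| ^+ 2
                        + r2 / 2 * `|y - v2| ^+ 2) s ->
  A v ->
  0 + dot b s + r1 / 2 * `|s - v1| ^+ 2 + r2 / 2 * `|s - v2| ^+ 2
    + (r1 + r2) / 2 * `|v - s| ^+ 2
  <= 0 + dot b v + r1 / 2 * `|v - v1| ^+ 2 + r2 / 2 * `|v - v2| ^+ 2.
Proof.
move=> cA [As sA] Av; rewrite !add0r.
apply: (quadratic_argmin_le hilbert (A := A) (c := dot b)) => //.
- by move=> t /andP[t0 t1]; apply: convex_set_comb => //; rewrite !ltW.
- by move=> t _; rewrite !(dotE dot).
Qed.

Lemma econvex_fin (g : U -> \bar R) x y (t : R) :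
  proper_function g -> econvex_function g -> 0 <= t <= 1 ->
  g x \is a fin_num -> g y \is a fin_num ->
  g (t *: x + (1 - t) *: y) \is a fin_num /\
  fine (g (t *: x + (1 - t) *: y)) <= t * fine (g x) + (1 - t) * fine (g y).
Proof.
move=> [gN _] gc t01 gx gy.
have := gc x y t t01.
rewrite -[X in (t%:E * X)%E](fineK gx) -[X in ((1 - t)%:E * X)%E](fineK gy).
rewrite -!EFinM -EFinD.
move: (gN (t *: x + (1 - t) *: y)).
by case: (g (t *: x + _)) => [r| |] //= _; rewrite lee_fin.
Qed.

Lemma argmin_proper (g : U -> \bar R) (b s v : U) (r : R) :
  proper_function g -> econvex_function g ->
  is_argmin setT (fun y => g y + (dot b y + r / 2 * `|y - v| ^+ 2)%:E)%E s ->
  g s \is a fin_num /\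
  (forall y, g y \is a fin_num ->
  fine (g s) + dot b s + r / 2 * `|s - v| ^+ 2 + 0 / 2 * `|s - 0| ^+ 2
    + (r + 0) / 2 * `|y - s| ^+ 2
  <= fine (g y) + dot b y + r / 2 * `|y - v| ^+ 2 + 0 / 2 * `|y - 0| ^+ 2).
Proof.
move=> gp gc [_ sA].
have gs : g s \is a fin_num.
  have [gN [z0 gz0]] := gp.
  have := sA z0 I; move: (gN s) (gN z0) gz0.
  by case: (g s) => [a| |] //; case: (g z0) => [a'| |].
split => // y gy.
apply: (quadratic_argmin_le hilbert (A := [set y | g y \is a fin_num])
  (c := fun y => fine (g y) + dot b y)) => //=.
- by move=> t /andP[t0 t1]; apply: (econvex_fin gp gc _ gy gs).1; rewrite !ltW.
- move=> t /andP[t0 t1].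
  have t01 : 0 <= t <= 1 by rewrite !ltW.
  by have := (econvex_fin gp gc t01 gy gs).2; rewrite !(dotE dot); lra.
- move=> x gx; rewrite !mul0r !addr0.
  have := sA x I; rewrite -(fineK gs) -(fineK gx) -!EFinD.
  by rewrite lee_fin !addrA.
Qed.

End argmin.

(** * The pathwise estimate *)

Section pathwise.
Context {R : realType} {U : normedModType R} (dot : {dot U for idfun}).
Hypothesis hilbert : norm_from_dot dot.
Variables (S : Type) (Uad : set U) (f : U -> R) (gradf : U -> U).
Variables (g : U -> \bar R) (gradF : U -> S -> U).
Variables (alpha L mu rho eta nu : R) (th : nat -> R) (m : nat -> nat).
Hypothesis Uad_convex : convex_set Uad.
Hypothesis Uad_nu : forall x y, Uad x -> Uad y -> `|x - y| ^+ 2 <= nu.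
Hypothesis f_strongly_convex : forall u v,
  f u + dot (gradf u) (v - u) + alpha / 2 * `|v - u| ^+ 2 <= f v.
Hypothesis f_convex : forall u v t, 0 <= t <= 1 ->
  f (t *: u + (1 - t) *: v) <= t * f u + (1 - t) * f v.
Hypothesis f_descent : forall a b,
  f b <= f a + dot (gradf a) (b - a) + L / 2 * `|b - a| ^+ 2.
Hypothesis g_proper : proper_function g.
Hypothesis g_convex : econvex_function g.
Hypothesis L_ge0 : 0 <= L.
Hypotheses (mu_in01 : 0 < mu < 1) (rho_gt0 : 0 < rho) (eta_gt0 : 0 < eta).
Hypothesis rho_eta_le_alpha : rho + eta <= alpha.
Hypothesis th0 : th 0%N = 1.
Hypothesis thS : forall k, 0 < th k.+1 /\ th k.+1 ^+ 2 = th k ^+ 2 + th k.+1.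
Variables (xs : nat -> nat -> S) (u0 z0 lam0 : U) (u z v s psi lam : nat -> U).
Hypothesis u0_in_Uad : Uad u0.
Hypothesis iterates : sadmm_iterates dot Uad g gradF mu
  (fun k => rho * th k) (fun k => eta * th k) th m xs u0 z0 lam0 u z v s psi lam.
Variable x : U.
Hypotheses (x_Uad : Uad x) (gx : g x \is a fin_num).

Local Notation q := (theta_sq_pred th).
Let th_ge1 := theta_ge1 th0 thS.
Let th_gt0 k : 0 < th k := lt_le_trans ltr01 (th_ge1 k).

Definition gradient_error k : U :=
  (m k)%:R^-1 *: \sum_(i < m k) gradF (v k) (xs k i) - gradf (v k).

Lemma v_in_Uad k : Uad (v k).
Proof.
by case: k => [|k]; [rewrite (sadmm_v0 iterates)|case: (sadmm_v iterates k)].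
Qed.

Lemma theta_inv01 k : 0 <= (th k)^-1 <= 1.
Proof. by rewrite invr_ge0 ltW//= invf_le1. Qed.

Lemma u_in_Uad k : Uad (u k).
Proof.
elim: k => [|k IH]; first by rewrite (sadmm_u0 iterates).
rewrite (sadmm_u iterates) addrC.
exact: convex_set_comb (theta_inv01 k) (v_in_Uad _) IH.
Qed.

Lemma s_fin k : g (s k.+1) \is a fin_num.
Proof.
by case: (argmin_proper hilbert g_proper g_convex (sadmm_s iterates k)).
Qed.

Lemma theta_sq_combination (a b : R) k :
  th k ^+ 2 * ((th k)^-1 * b + (1 - (th k)^-1) * a) = q k * a + th k * b.
Proof.
have -> : q k = th k ^+ 2 - th k by rewrite (theta_sqE th0 thS) addrK.
by field; rewrite gt_eqF.
Qed.

Lemma z_convex_comb k : g (z k.+1) \is a fin_num /\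
  q k.+1 * fine (g (z k.+1)) <= q k * fine (g (z k)) + th k * fine (g (s k.+1)).
Proof.
elim: k => [|k [IH _]].
  rewrite (sadmm_z iterates) th0 invr1 subrr scale0r add0r scale1r s_fin.
  by rewrite /= th0 expr1n mul0r add0r.
rewrite (sadmm_z iterates) addrC.
have [fz le] := econvex_fin g_proper g_convex (theta_inv01 k.+1) (s_fin k.+1) IH.
split => //; rewrite -theta_sq_combination /=.
by rewrite ler_pM2l ?exprn_gt0.
Qed.

Lemma u_convex_comb k :
  q k.+1 * f (u k.+1) <= q k * f (u k) + th k * f (v k.+1).
Proof.
rewrite (sadmm_u iterates) addrC -theta_sq_combination /=.
by rewrite ler_pM2l ?exprn_gt0//; exact: f_convex (theta_inv01 k).
Qed.

Definition constraint_sum k : U := q k *: (u k - z k).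

Lemma constraint_sumS k :
  constraint_sum k.+1 = constraint_sum k + th k *: (v k.+1 - s k.+1).
Proof.
rewrite /constraint_sum (sadmm_u iterates) (sadmm_z iterates).
have -> : q k = th k ^+ 2 - th k by rewrite (theta_sqE th0 thS) addrK.
have -> (a b c d : U) (r : R) : r *: a + b - (r *: c + d) = r *: (a - c) + (b - d).
  by rewrite opprD addrACA scalerBr.
rewrite -scalerBr scalerDr !scalerA /=; congr (_ *: _ + _ *: _).
  by field; rewrite gt_eqF.
by field; rewrite gt_eqF.
Qed.

Lemma psiE k : psi k = lam0 - (mu * rho) *: constraint_sum k.
Proof.
elim: k => [|k IH].
  by rewrite (sadmm_psi0 iterates) /constraint_sum /= scale0r scaler0 subr0.
rewrite (sadmm_psi iterates) IH constraint_sumS [in RHS]scalerDr opprD addrA.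
by rewrite scalerA !mulrA.
Qed.

Lemma lamE k : lam k = lam0 - (2 * mu * rho) *: constraint_sum k.
Proof.
case: k => [|k].
  by rewrite (sadmm_lam0 iterates) /constraint_sum /= scale0r scaler0 subr0.
rewrite (sadmm_lam iterates) psiE -addrA -opprD; congr (_ - _).
rewrite -!mulrA [2 * _]mulr_natl mulr2n scalerDl; congr (_ + _).
by rewrite /constraint_sum /= scalerA expr2 !mulrA.
Qed.

Lemma one_step_bound k :
  f (v k.+1) + fine (g (s k.+1)) - f x - fine (g x) <=
  dot (lam k) (v k.+1 - s k.+1) - dot (gradient_error k) (v k.+1 - x)
  + ((rho + eta) * th k - alpha) / 2 * `|x - v k| ^+ 2
  - (rho + eta) * th k / 2 * `|x - v k.+1| ^+ 2
  - rho * th k / 2 * `|s k.+1 - v k| ^+ 2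
  - rho * th k / 2 * `|v k.+1 - s k.+1| ^+ 2
  + (L - eta * th k) / 2 * `|v k.+1 - v k| ^+ 2.
Proof.
have [_ /(_ _ gx)] := argmin_proper hilbert g_proper g_convex (sadmm_s iterates k).
have := argmin_convex_set hilbert Uad_convex (sadmm_v iterates k) x_Uad.
have := f_strongly_convex (v k) x.
have := f_descent (v k) (v k.+1).
rewrite /gradient_error; set G := _ *: _.
rewrite !(dotE dot).
move=> H1 H2 H3 H4; lra.
Qed.

(* [N] stands for [2 * kappa]: from index [N] on, [eta * theta_k] dominates [L]
   and the proximal term absorbs all of the cross term with the noise. *)
Variables (phi : R) (N : nat).
Hypothesis phi_gt0 : 0 < phi.
Hypothesis phi_small : 1 <= phi * (eta - rho * (mu / (1 - mu))).
Hypothesis phi_large : forall k, (N <= k)%N ->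
  th k <= phi * ((eta - rho * (mu / (1 - mu))) * th k - L).

Definition noise k : R := - th k * dot (gradient_error k) (v k - x)
  + phi / 2 * `|gradient_error k| ^+ 2.

Definition gap_value k : R := f (u k) + fine (g (z k)) - f x - fine (g x).

Let early k : R := if (k < N)%N then L / 2 * nu * th k else 0.

Lemma split_norm_bound (a b : U) :
  mu * `|a - b| ^+ 2 <= mu / (1 - mu) * `|a| ^+ 2 + `|b| ^+ 2.
Proof.
have /andP[mu0 mu1] := mu_in01.
have m1 : 0 < 1 - mu by rewrite subr_gt0.
have := norm_convex_comb_sq hilbert mu a b.
move: (`|a - b| ^+ 2) (`|a| ^+ 2) (`|b| ^+ 2) => X Y Z H.
rewrite -(ler_pM2l m1).
have -> : (1 - mu) * (mu / (1 - mu) * Y + Z) = mu * Y + (1 - mu) * Z.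
  by field; rewrite gt_eqF.
by apply: le_trans H; rewrite mulrCA mulrA.
Qed.

Lemma noise_absorption k :
  - th k * dot (gradient_error k) (v k.+1 - v k)
  - th k / 2 * ((eta - rho * (mu / (1 - mu))) * th k - L)
      * `|v k.+1 - v k| ^+ 2
  <= phi / 2 * `|gradient_error k| ^+ 2 + early k.
Proof.
have phiV : 0 < phi^-1 by rewrite invr_gt0.
have := young_dot hilbert (gradient_error k) (th k *: (v k.+1 - v k)) phiV.
rewrite invrK (normZ_sq (th k)) (dotZr dot).
have := Uad_nu (v_in_Uad k.+1) (v_in_Uad k).
have : 0 <= `|v k.+1 - v k| ^+ 2 by rewrite sqr_ge0.
have pp : phi^-1 * phi = 1 by rewrite mulVf// gt_eqF.
move: (dot _ _) (`|v k.+1 - v k| ^+ 2) (`|gradient_error k| ^+ 2) => d A E.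
move: phi_small (@phi_large k); rewrite /early.
move: (eta - _) => e' ps pl A0 An H.
have t0 := th_gt0 k; move: (th k) t0 pl H => t t0 pl H.
have pV : phi^-1 <= e' by rewrite -(ler_pM2l phi_gt0) mulrC pp.
case: ltnP => kN.
  have H1 : phi^-1 / 2 * (t ^+ 2 * A) <= e' / 2 * (t ^+ 2 * A).
    apply: ler_wpM2r; first exact: mulr_ge0 (sqr_ge0 t) A0.
    by rewrite ler_pM2r// invr_gt0.
  have H2 : L / 2 * t * A <= L / 2 * t * nu.
    by apply: ler_wpM2l => //; rewrite !mulr_ge0 ?invr_ge0// ltW.
  by lra.
have H1 : phi^-1 * t <= e' * t - L.
  by rewrite -(ler_pM2l phi_gt0) mulrA mulfV ?gt_eqF// mul1r pl.
have H2 : (t / 2 * A) * (phi^-1 * t) <= (t / 2 * A) * (e' * t - L).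
  by apply: ler_wpM2l => //; rewrite mulr_ge0// divr_ge0// ltW.
by lra.
Qed.

Lemma energy_step k :
  q k.+1 * gap_value k.+1 <= q k * gap_value k
  + dot lam0 (constraint_sum k.+1 - constraint_sum k)
  - mu * rho * (`|constraint_sum k.+1| ^+ 2 - `|constraint_sum k| ^+ 2)
  + (rho + eta) / 2 * (q k * `|x - v k| ^+ 2 - q k.+1 * `|x - v k.+1| ^+ 2)
  + early k + noise k.
Proof.
have H1 := u_convex_comb k.
have [_ H2] := z_convex_comb k.
have H3 := ler_wpM2l (ltW (th_gt0 k)) (one_step_bound k).
have H4 := noise_absorption k.
have E : q k.+1 = q k + th k by rewrite -(theta_sqE th0 thS).
have qE : q k = th k ^+ 2 - th k by rewrite (theta_sqE th0 thS) addrK.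
have H5 : th k * ((rho + eta) * th k - alpha) * `|x - v k| ^+ 2 <=
    (rho + eta) * (th k ^+ 2 - th k) * `|x - v k| ^+ 2.
  apply: ler_wpM2r; first exact: sqr_ge0.
  have := th_gt0 k; move: rho_eta_le_alpha.
  by move: (th k) => t; nra.
have H6 : rho * th k ^+ 2 / 2 * (mu * `|v k.+1 - s k.+1| ^+ 2) <=
    rho * th k ^+ 2 / 2 * (mu / (1 - mu) * `|v k.+1 - v k| ^+ 2
                           + `|s k.+1 - v k| ^+ 2).
  apply: ler_wpM2l; first by rewrite mulr_ge0// mulr_ge0 ?sqr_ge0 ?ltW.
  have -> : v k.+1 - s k.+1 = (v k.+1 - v k) - (s k.+1 - v k).
    by rewrite opprB addrA subrK.
  exact: split_norm_bound.
have H7 : 0 <= (1 - mu) * (rho * th k ^+ 2 / 2 * `|v k.+1 - s k.+1| ^+ 2).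
  have /andP[_ mu1] := mu_in01.
  apply: mulr_ge0; first by rewrite subr_ge0 ltW.
  apply: mulr_ge0 (sqr_ge0 _); apply: divr_ge0 => //.
  exact: mulr_ge0 (ltW rho_gt0) (sqr_ge0 _).
rewrite /gap_value /noise.
have vE : dot (gradient_error k) (v k.+1 - x) =
    dot (gradient_error k) (v k.+1 - v k) + dot (gradient_error k) (v k - x).
  by rewrite -(dotDr dot) addrA subrK.
have dE : dot (lam k) (v k.+1 - s k.+1) * th k = dot lam0 (constraint_sum k.+1 - constraint_sum k)
   - mu * rho * (`|constraint_sum k.+1| ^+ 2 - `|constraint_sum k| ^+ 2)
   + mu * rho * (th k ^+ 2 * `|v k.+1 - s k.+1| ^+ 2).
  have -> : constraint_sum k.+1 - constraint_sum k = th k *: (v k.+1 - s k.+1).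
    by rewrite constraint_sumS addrAC subrr add0r.
  rewrite mulrC -(dotZr dot) lamE constraint_sumS.
  rewrite (normD_sq hilbert) (normZ_sq (th k)) !(dotBl dot) !(dotZl dot); ring.
move: H1 H2 H3 H4 H5 H6 H7; rewrite vE E qE => H1 H2 H3 H4 H5 H6 H7.
move: (mu / (1 - mu)) H4 H6 => r H4 H6.
lra.
Qed.

Lemma energy_bound K : q K * gap_value K <=
  dot lam0 (constraint_sum K) - mu * rho * `|constraint_sum K| ^+ 2
  - (rho + eta) / 2 * (q K * `|x - v K| ^+ 2)
  + L / 2 * nu * q (minn K N) + \sum_(k < K) noise k.
Proof.
elim: K => [|K IH].
  rewrite big_ord0 min0n /= /constraint_sum /= scale0r normr0 expr0n /=.
  by rewrite (dot0r dot) !(mulr0, mul0r) !subr0 !addr0.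
apply: le_trans (energy_step K) _.
have qm : L / 2 * nu * q (minn K N) + early K <= L / 2 * nu * q (minn K.+1 N).
  rewrite /early; case: (ltnP K N) => KN.
    by rewrite (minn_idPl KN) -mulrDr -(theta_sqE th0 thS).
  by rewrite (minn_idPr (leqW KN)) addr0.
rewrite big_ord_recr /= (dotBr dot).
move: IH qm; move: (q K.+1 * _) (q K * `|_| ^+ 2) (q K * _) => a b e; lra.
Qed.

Lemma pathwise_bound c K : 0 <= c ->
  q K * gap_value K + c * (q K * `|u K - z K|) <=
  (c ^+ 2 + `|lam0| ^+ 2) / (2 * (mu * rho)) + L / 2 * nu * q N
  + \sum_(k < K) noise k.
Proof.
move=> c0.
have qK := theta_sq_pred_ge0 th K.
have -> : q K * `|u K - z K| = `|constraint_sum K|.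
  by rewrite normrZ ger0_norm.
apply: le_trans (lerD (energy_bound K) (lexx _)) _.
have := Cauchy_Schwarz_dot hilbert lam0 (constraint_sum K).
have : 0 <= (rho + eta) / 2 * (q K * `|x - v K| ^+ 2).
  apply: mulr_ge0; first by rewrite divr_ge0// addr_ge0// ltW.
  exact: mulr_ge0 qK (sqr_ge0 _).
have : L / 2 * nu * q (minn K N) <= L / 2 * nu * q N.
  have nu0 : 0 <= nu by apply: le_trans (Uad_nu x_Uad x_Uad); rewrite sqr_ge0.
  apply: ler_wpM2l; first by rewrite !mulr_ge0.
  by apply: (theta_sq_pred_mono th0 thS); exact: geq_minr.
have mr : 0 < mu * rho by case/andP: mu_in01 => m0 _; rewrite mulr_gt0.
have -> : (c ^+ 2 + `|lam0| ^+ 2) / (2 * (mu * rho)) =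
    (c ^+ 2 + `|lam0| ^+ 2) / 2 * (mu * rho)^-1.
  by rewrite invfM mulrA.
have rm : (mu * rho)^-1 * (mu * rho) = 1 by rewrite mulVf// gt_eqF.
have ri : 0 < (mu * rho)^-1 by rewrite invr_gt0.
move: (mu * rho) (mu * rho)^-1 mr rm ri => p r p0 rp r0.
move: (dot _ _) (q (minn _ _)) => d a.
set X := `|constraint_sum K|; set l := `|lam0|; set Q := q N.
move=> H1 H2 H3.
have : (c + l) * X - p * X ^+ 2 <= (c ^+ 2 + l ^+ 2) / 2 * r.
  have : 0 <= r / 4 * (2 * (p * X) - (c + l)) ^+ 2 + r / 4 * (c - l) ^+ 2.
    by rewrite addr_ge0// mulr_ge0 ?sqr_ge0// divr_ge0// ltW.
  have -> : r / 4 * (2 * (p * X) - (c + l)) ^+ 2 + r / 4 * (c - l) ^+ 2 =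
    (r * p) * p * X ^+ 2 - (r * p) * X * (c + l) + (c ^+ 2 + l ^+ 2) / 2 * r.
    by field.
  rewrite rp; lra.
lra.
Qed.

Lemma gap_value_ge lamstar K : optimal_multiplier dot Uad gradf g x x lamstar ->
  g (z K) \is a fin_num -> 0 <= alpha ->
  - (`|lamstar| * `|u K - z K|) <= gap_value K.
Proof.
move=> /(_ (u K) (z K) (u_in_Uad K)) + gz a0.
rewrite -(fineK gz) -(fineK gx) -!(EFinB, EFinD) lee_fin => H.
have := Cauchy_Schwarz_dotN hilbert lamstar (u K - z K).
have := f_strongly_convex x (u K).
have : 0 <= alpha / 2 * `|u K - x| ^+ 2.
  by apply: mulr_ge0 (sqr_ge0 _); rewrite divr_ge0.
by rewrite /gap_value /=; lra.
Qed.

End pathwise.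

(** * Separable measurability *)

(* Strong measurability of functions into a normed module in the form of
   Pettis's criterion, phrased with distances to points. *)
Definition separably_measurable (d : measure_display) (T : measurableType d)
    (R : realType) (V : normedModType R) (X : T -> V) : Prop :=
  (exists q : nat -> V, forall w (e : R), 0 < e -> exists n, `|X w - q n| < e) /\
  (forall y, measurable_fun setT (fun w => `|X w - y|)).

Lemma measurable_selection (d : measure_display) (T : measurableType d)
    (F : nat -> set T) :
  (forall n, measurable (F n)) -> (forall w, exists n, F n w) ->
  exists N : T -> nat,
    (forall n, measurable (N @^-1` [set n])) /\ forall w, F (N w) w.
Proof.
move=> mF hF.
have hF' w : exists n, `[< F n w >] by have [n Fn] := hF w; exists n; apply/asboolP.
exists (fun w => ex_minn (hF' w)); split => [n|w]; last first.
  by case: ex_minnP => n /asboolP.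
rewrite (_ : _ @^-1` _ = F n `\` \bigcup_(i < n) F i).
  apply: measurableD => //; apply: bigcup_measurable => k _; exact: mF.
apply/seteqP; split => w /=; case: ex_minnP => k /asboolP Fk kmin.
  move=> <-; split=> // -[i /= ik Fi].
  by have := kmin i (introT (asboolP _) Fi); rewrite leqNgt ik.
move=> [Fn nF]; apply/eqP; rewrite eqn_leq kmin ?andTb; last exact/asboolP.
by rewrite leqNgt; apply/negP => kn; apply: nF; exists k.
Qed.

Section separably_measurable.
Context {d : measure_display} {T : measurableType d} {R : realType}.

Lemma preimage_index_measurable (N : T -> nat) (A : nat -> set T) :
  (forall n, measurable (N @^-1` [set n])) -> (forall n, measurable (A n)) ->
  measurable [set w | A (N w) w].
Proof.
move=> mN mA.
rewrite (_ : mkset _ = \bigcup_n (N @^-1` [set n] `&` A n)).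
  by apply: bigcupT_measurable => n; apply: measurableI.
by apply/seteqP; split => w /=; [exists (N w)|move=> [n _ [/= ->]]].
Qed.

Lemma separably_measurable_glue (V : normedModType R) (N : T -> nat)
    (Z : nat -> T -> V) :
  (forall n, measurable (N @^-1` [set n])) ->
  (forall n, separably_measurable (Z n)) ->
  separably_measurable (fun w => Z (N w) w).
Proof.
move=> mN sZ; split.
  have /choice[q hq] : forall n, exists q : nat -> V,
    forall w (e : R), 0 < e -> exists i, `|Z n w - q i| < e.
    by move=> n; have [] := sZ n.
  exists (fun k => if @pickle_inv (nat * nat)%type k is Some p then q p.1 p.2 else 0).
  move=> w e e0; have [i hi] := hq (N w) w e e0.
  by exists (pickle (N w, i)); rewrite pickleK_inv.
move=> y _ B mB; rewrite setTI.
apply: (preimage_index_measurable (A := fun n => (fun w => `|Z n w - y|) @^-1` B)) => //.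
by move=> n; rewrite -[X in measurable X]setTI; have [_ /(_ y)] := sZ n; apply.
Qed.

Lemma separably_measurable_cst (V : normedModType R) (y : V) :
  separably_measurable (fun _ : T => y).
Proof.
split; last by move=> z; exact: measurable_cst.
by exists (fun=> y) => w e e0; exists 0%N; rewrite subrr normr0.
Qed.

Lemma separably_measurable_cvg (V : normedModType R) (X : nat -> T -> V) (Y : T -> V) :
  (forall j, separably_measurable (X j)) ->
  (forall w, X j w @[j --> \oo] --> Y w) -> separably_measurable Y.
Proof.
move=> sX XY; split.
  have /choice[q hq] : forall n, exists q : nat -> V,
    forall w (e : R), 0 < e -> exists i, `|X n w - q i| < e.
    by move=> n; have [] := sX n.
  exists (fun k => if @pickle_inv (nat * nat)%type k is Some p then q p.1 p.2 else 0).
  move=> w e e0.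
  have e20 : 0 < e / 2 by rewrite divr_gt0.
  have /cvgrPdist_lt/(_ _ e20)[n _ /(_ n (leqnn n)) /= Hn] := XY w.
  have [i hi] := hq n w _ e20.
  exists (pickle (n, i)); rewrite pickleK_inv /=.
  by rewrite -(subrKA (X n w)) (splitr e); exact: le_lt_trans (ler_normD _ _) (ltrD Hn hi).
move=> y; apply: (measurable_fun_cvg (h := fun j w => `|X j w - y|)).
  by move=> j; have [_ /(_ y)] := sX j.
move=> w _; apply: cvg_norm; apply: cvgB => //; exact: cvg_cst.
Qed.

Lemma separably_measurable_index (V : normedModType R) (X : T -> V) :
  separably_measurable X -> exists (q : nat -> V) (N : nat -> T -> nat),
    (forall j n, measurable (N j @^-1` [set n])) /\
    forall j w, `|X w - q (N j w)| < j.+1%:R^-1.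
Proof.
move=> [[q hq] mX]; exists q.
have /choice[N hN] : forall j, exists N : T -> nat,
    (forall n, measurable (N @^-1` [set n])) /\
    forall w, [set w | `|X w - q (N w)| < j.+1%:R^-1 ] w.
  move=> j; apply: (measurable_selection (F := fun n => [set w | `|X w - q n| < j.+1%:R^-1 ])).
    move=> n; rewrite -[X in measurable X]setTI.
    rewrite (_ : mkset _ = (fun w => `|X w - q n|) @^-1` `]-oo, j.+1%:R^-1[).
      exact: mX.
    by apply/seteqP; split => w; rewrite /= in_itv.
  by move=> w; apply: hq; rewrite invr_gt0.
by exists N; split=> [j n|j w]; [exact: (hN j).1|exact: (hN j).2].
Qed.

Lemma cvg_inv_succ (V : normedModType R) (x : nat -> V) (y : V) :
  (forall j, `|y - x j| < j.+1%:R^-1) -> x j @[j --> \oo] --> y.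
Proof.
move=> h; apply/cvgrPdist_lt => e e0.
near=> j; apply: lt_trans (h j) _.
near: j; exact: (near_infty_natSinv_lt (PosNum e0)).
Unshelve. all: by end_near. Qed.

Lemma separably_measurable_caratheodory (V W : normedModType R)
    (H : V -> T -> W) (X : T -> V) :
  (forall w, continuous (H ^~ w)) -> (forall y, separably_measurable (H y)) ->
  separably_measurable X -> separably_measurable (fun w => H (X w) w).
Proof.
move=> cH sH /separably_measurable_index[q [N [mN XN]]].
apply: (separably_measurable_cvg (X := fun j w => H (q (N j w)) w)).
  by move=> j; apply: (separably_measurable_glue (Z := fun n => H (q n))).
move=> w; apply: (continuous_cvg _ (cH w (X w))).
exact: (cvg_inv_succ (XN ^~ w)).
Qed.

Lemma separably_measurable_comp (V W : normedModType R) (h : V -> W) (X : T -> V) :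
  continuous h -> separably_measurable X -> separably_measurable (h \o X).
Proof.
move=> ch; apply: (separably_measurable_caratheodory (H := fun y _ => h y)) => //.
by move=> y; exact: separably_measurable_cst.
Qed.

Lemma separably_measurableD (V : normedModType R) (X Y : T -> V) :
  separably_measurable X -> separably_measurable Y ->
  separably_measurable (fun w => X w + Y w).
Proof.
move=> sX [[q hq] mY].
apply: (separably_measurable_caratheodory (H := fun x w => x + Y w)) sX.
  by move=> w x; apply: cvgD; [exact: cvg_id|exact: cvg_cst].
move=> x; split.
  exists (fun n => x + q n) => w e /hq-/(_ w)[n hn].
  by exists n; rewrite opprD addrACA subrr add0r.
move=> y; rewrite (_ : (fun _ => _) = (fun w => `|Y w - (y - x)|)) //.
by apply/funext => w; rewrite opprB addrCA addrA.
Qed.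

Lemma separably_measurableZ (V : normedModType R) (a : R) (X : T -> V) :
  separably_measurable X -> separably_measurable (fun w => a *: X w).
Proof. by apply: separably_measurable_comp; exact: scaler_continuous. Qed.

Lemma separably_measurableB (V : normedModType R) (X Y : T -> V) :
  separably_measurable X -> separably_measurable Y ->
  separably_measurable (fun w => X w - Y w).
Proof.
move=> sX sY; apply: separably_measurableD => //.
rewrite (_ : (fun _ => _) = (fun w => -1 *: Y w)).
  exact: separably_measurableZ.
by apply/funext => w; rewrite scaleN1r.
Qed.

Lemma separably_measurable_sum (V : normedModType R) (n : nat) (X : 'I_n -> T -> V) :
  (forall i, separably_measurable (X i)) ->
  separably_measurable (fun w => \sum_(i < n) X i w).
Proof.
elim: n X => [|n IH] X sX.
  rewrite (_ : (fun _ => _) = cst 0); first exact: separably_measurable_cst.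
  by apply/funext => w; rewrite big_ord0.
rewrite (_ : (fun _ => _) =
    (fun w => \sum_(i < n) X (widen_ord (leqnSn n) i) w + X ord_max w)).
  by apply: separably_measurableD => //; apply: IH.
by apply/funext => w; rewrite big_ord_recr.
Qed.

Lemma separably_measurable_pair (V W : normedModType R) (X : T -> V) (Y : T -> W) :
  separably_measurable X -> separably_measurable Y ->
  separably_measurable (fun w => (X w, Y w) : (V * W)%type).
Proof.
move=> [[p hp] mX] [[q hq] mY]; split.
  exists (fun k => if @pickle_inv (nat * nat)%type k is Some i then (p i.1, q i.2) else (0, 0)).
  move=> w e e0; have [i hi] := hp w e e0; have [j hj] := hq w e e0.
  exists (pickle (i, j)); rewrite pickleK_inv /=.
  by rewrite prod_normE /= gt_max hi hj.
move=> y; rewrite (_ : (fun _ => _) = (fun w => Num.max `|X w - y.1| `|Y w - y.2|)).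
  by apply: measurable_maxr.
by apply/funext => w; rewrite prod_normE.
Qed.

(* Countably many sample points suffice to approximate [X], so a relation
   between values of [Z] and values of [X] can be used without writing [Z] as a
   function of [X] on the whole space. *)
Lemma separably_measurable_lipschitz (V W : normedModType R)
    (X : T -> V) (Z : T -> W) (C : R) :
  (forall w w', `|Z w - Z w'| <= C * `|X w - X w'|) ->
  separably_measurable X -> separably_measurable Z.
Proof.
move=> ZX /[dup] sX /separably_measurable_index[q [N [mN XN]]].
have [w0|T0] := pselect (exists w : T, True); last first.
  apply: (separably_measurable_cvg (X := fun _ => Z)) => [_|w]; last by case: T0; exists w.
  split; first by exists (fun=> 0) => w; case: T0; exists w.
  by move=> y _ B _; rewrite (_ : _ `&` _ = set0)//; apply/seteqP; split=> // w; case: T0; exists w.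
have /choice[sel hsel] : forall p : nat * nat, exists w',
   (exists w, N p.1 w = p.2) -> N p.1 w' = p.2.
  move=> p; have [[w hw]|h] := pselect (exists w, N p.1 w = p.2); first by exists w.
  by case: w0 => w _; exists w.
have XN2 j w : `|X w - X (sel (j, N j w))| <= 2 * j.+1%:R^-1.
  have E : N j (sel (j, N j w)) = N j w by apply: (hsel (j, N j w)); exists w.
  rewrite mulr_natl mulr2n -(subrKA (q (N j w))).
  apply: le_trans (ler_normD _ _) (lerD (ltW (XN j w)) _).
  by have := XN j (sel (j, N j w)); rewrite E distrC => /ltW.
apply: (separably_measurable_cvg (X := fun j w => Z (sel (j, N j w)))).
  move=> j; apply: (separably_measurable_glue (Z := fun n _ => Z (sel (j, n)))) => // n.
  exact: separably_measurable_cst.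
move=> w; apply/cvgrPdist_le => e e0.
have C0 : 0 < 2 * `|C| + 1 by rewrite ltr_wpDl.
have eC : 0 < e / (2 * `|C| + 1) by rewrite divr_gt0.
near=> j.
apply: le_trans (ZX _ _) _.
apply: (@le_trans _ _ (`|C| * (2 * j.+1%:R^-1))).
  apply: (@le_trans _ _ (`|C| * `|X w - X (sel (j, N j w))|)).
    by apply: ler_wpM2r => //; exact: ler_norm.
  exact: ler_wpM2l.
apply: (@le_trans _ _ ((2 * `|C| + 1) * j.+1%:R^-1)).
  by rewrite mulrCA mulrA ler_wpM2r// lerDl.
rewrite mulrC -ler_pdivlMr//; apply: ltW.
near: j; exact: (near_infty_natSinv_lt (PosNum eC)).
Unshelve. all: by end_near. Qed.

Lemma separably_measurable_norm (V : normedModType R) (X : T -> V) :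
  separably_measurable X -> measurable_fun setT (fun w => `|X w|).
Proof.
move=> [_ /(_ 0)]; rewrite (_ : (fun _ => _) = (fun w => `|X w|))//.
by apply/funext => w; rewrite subr0.
Qed.

Lemma separably_measurable_open (V : normedModType R) (X : T -> V) (O : set V) :
  open O -> separably_measurable X -> measurable (X @^-1` O).
Proof.
move=> oO sX; have [[q hq] mX] := sX.
pose A (n k : nat) : set T :=
  [set w | ball (q n) k.+1%:R^-1 `<=` O /\ `|X w - q n| < k.+1%:R^-1].
rewrite (_ : _ @^-1` _ = \bigcup_n \bigcup_k A n k).
  apply: bigcupT_measurable => n; apply: bigcupT_measurable => k.
  have [h|h] := pselect (ball (q n) k.+1%:R^-1 `<=` O); last first.
    by rewrite (_ : A n k = set0)//; apply/seteqP; split=> // w [].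
  rewrite (_ : A n k = setT `&` (fun w => `|X w - q n|) @^-1` `]-oo, k.+1%:R^-1[).
    exact: mX.
  apply/seteqP; split => w; rewrite /A /= in_itv //=; first by move=> [_ ?].
  by move=> [_ ?].
apply/seteqP; split => w /=; last first.
  move=> [n _ [k _ [h /= Xw]]]; apply: h.
  by rewrite -ball_normE /= distrC.
move=> Ow; have /nbhs_ballP[e /= e0 he] : nbhs (X w) O by exact: open_nbhs_nbhs.
have e20 : 0 < e / 2 by rewrite divr_gt0.
have [k _ /(_ k (leqnn k)) /= hk] := near_infty_natSinv_lt (PosNum e20).
have k0 : 0 < k.+1%:R^-1 :> R by rewrite invr_gt0.
have [n hn] := hq w _ k0.
exists n => //; exists k => //; split=> // y.
rewrite -ball_normE /= => qy; apply: he; rewrite -ball_normE /=.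
rewrite -(subrKA (q n)) (splitr e).
by apply: le_lt_trans (ler_normD _ _) (ltrD _ _); [exact: lt_trans hn _|exact: lt_trans qy _].
Qed.

Lemma lower_semicontinuous_comp_measurable (V : normedModType R)
    (g : V -> \bar R) (X : T -> V) :
  lower_semicontinuous g -> separably_measurable X ->
  measurable_fun setT (g \o X).
Proof.
move=> /lower_semicontinuousP lg sX.
apply: (measurability _ (ErealGenOInfty.measurableE R)) => // _ [_ [a ->] <-].
rewrite setTI preimage_itvoy; apply: (separably_measurable_open (lg a)) sX.
Qed.

Lemma simple_vector_fun_separably_measurable (V : normedModType R) (s : T -> V) :
  simple_vector_fun s -> separably_measurable s.
Proof.
move=> [fs ms]; split.
  have /finite_seqP[r hr] := fs.
  exists (fun n => nth 0 r n) => w e e0.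
  have sr : s w \in r by have : range s (s w) by [exists w]; rewrite hr.
  by exists (index (s w) r); rewrite nth_index// subrr normr0.
move=> y _ B mB; rewrite setTI.
rewrite (_ : _ @^-1` _ = \bigcup_(z in range s `&` [set z | B `|z - y|]) (s @^-1` [set z])).
  by apply: fin_bigcup_measurable => [|z _]; [exact: finite_setIl|exact: ms].
apply/seteqP; split => w /=; first by move=> Bw; exists (s w).
by move=> [z [_ /= Bz] /= ->].
Qed.

End separably_measurable.

Lemma strongly_measurable_comp (d d' : measure_display) (T : measurableType d)
    (T' : measurableType d') (R : realType) (V : normedModType R) (D : set T')
    (X : T' -> V) (x : T -> T') :
  strongly_measurable D X -> measurable_fun setT x -> (forall w, D (x w)) ->
  separably_measurable (X \o x).
Proof.
move=> [s [ss hs]] mx Dx.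
apply: (separably_measurable_cvg (X := fun j => s j \o x)) => [j|w]; last exact: hs.
apply: simple_vector_fun_separably_measurable; have [fs ms] := ss j; split.
  apply: (sub_finite_set _ fs) => _ [w _ <-]; by exists (x w).
by move=> y; rewrite comp_preimage -[X in measurable X]setTI; apply: mx => //.
Qed.

Lemma separably_measurable_sub (d : measure_display) (T : measurableType d)
    (G : set (set T)) (R : realType) (V : normedModType R) (X : T -> V) :
  (forall A, <<s G >> A -> measurable A) ->
  separably_measurable (X : g_sigma_algebraType G -> V) -> separably_measurable X.
Proof.
move=> sGm [sX mX]; split=> // y _ B mB; apply: sGm.
exact: (mX y measurableT B mB).
Qed.

(** * Independence and decoupling *)

Section independence.
Context {d d' : measure_display} {T : measurableType d} {T' : measurableType d'}.
Context {R : realType} (P : probability T R) {I : choiceType}.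
Variables (D : set I) (X : I -> {mfun T >-> T'}).

Definition cylinders (E : set I) : set (set T) :=
  [set A | exists (J : seq I) (B : I -> set T'),
    [/\ forall i, i \in J -> E i, forall i, i \in J -> measurable (B i)
      & A = \bigcap_(i in [set` J]) (X i @^-1` B i)]].

Lemma cylinders_measurable E : cylinders E `<=` measurable.
Proof.
move=> _ [J [B [_ mB ->]]]; apply: fin_bigcap_measurable => // i iJ.
by rewrite -[X in measurable X]setTI; apply: measurable_funPT => //; exact: mB.
Qed.

Lemma cylindersT E : cylinders E setT.
Proof.
exists [::], (fun=> setT); split=> //.
by apply/esym/seteqP; split.
Qed.

Lemma cylinders_setI E : setI_closed (cylinders E).
Proof.
move=> _ _ [J [B [JE mB ->]]] [J' [B' [JE' mB' ->]]].
exists (J ++ J'), (fun i => (if i \in J then B i else setT)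
                    `&` (if i \in J' then B' i else setT)); split.
- by move=> i; rewrite mem_cat => /orP[/JE|/JE'].
- move=> i _; apply: measurableI.
    by case: ifPn => // /mB.
  by case: ifPn => // /mB'.
- apply/seteqP; split=> w /=.
    move=> [BJ BJ'] i /= _; split; case: ifPn => // iJ; [exact: BJ|exact: BJ'].
  move=> h; split=> i /= iJ.
    by have := h i; rewrite /= mem_cat iJ => /(_ isT)[].
  by have := h i; rewrite /= mem_cat iJ orbT => /(_ isT)[].
Qed.

Lemma cylinders_preimage E i B : E i -> measurable B ->
  <<s cylinders E >> (X i @^-1` B).
Proof.
move=> Ei mB; apply: sub_sigma_algebra; exists [:: i], (fun=> B); split=> //.
  by move=> j; rewrite inE => /eqP ->.
apply/seteqP; split => w /=; first by move=> Bw j /=; rewrite inE => /eqP ->.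
by apply; rewrite /= inE.
Qed.

Lemma sigma_cylinders_measurable E A : <<s cylinders E >> A -> measurable A.
Proof.
apply: smallest_sub; last exact: cylinders_measurable.
exact: sigma_algebra_measurable.
Qed.

Lemma independent_cylinders E p A B : mutually_independent P D X ->
  E `<=` D -> D p -> ~ E p -> <<s cylinders E >> A -> measurable B ->
  P (A `&` X p @^-1` B) = (P (X p @^-1` B) * P A)%E.
Proof.
move=> indep ED Dp Ep sA mB.
have mXB : measurable (X p @^-1` B).
  by rewrite -[X in measurable X]setTI; exact: measurable_funPT.
have c0 : 0 <= fine (P (X p @^-1` B)) by rewrite fine_ge0.
have cE : (fine (P (X p @^-1` B)))%:E = P (X p @^-1` B).
  by rewrite fineK// fin_num_measure.
rewrite -cE.
pose m1 : {measure set T -> \bar R} := mrestr P mXB.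
pose m2 : {measure set T -> \bar R} := mscale (NngNum c0) P.
apply: (@g_sigma_algebra_measure_unique _ _ _ _ (@cylinders_measurable E)
  (fun=> setT) _ _ m1 m2 (@cylinders_setI E)) sA.
- by move=> _; exact: cylindersT.
- by apply/seteqP; split=> // w _; exists 0%N.
- move=> _ [J [C [JE mC ->]]]; rewrite /m1 /m2 /= /mrestr /mscale /= cE.
  have -> : [set` J] = [set` undup J].
    by apply/seteqP; split=> i /=; rewrite mem_undup.
  have h := indep (undup J) C (undup_uniq J).
  rewrite h; last first.
  + by move=> i; rewrite mem_undup => /mC.
  + by move=> i; rewrite mem_undup => /JE/ED.
  have := indep (p :: undup J) (fun i => if i == p then B else C i).
  have pJ : p \notin undup J by rewrite mem_undup; apply/negP => /JE.
  have neq i : i \in undup J -> (i == p) = false.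
    by move=> iJ; apply/negP => /eqP ip; rewrite ip (negbTE pJ) in iJ.
  rewrite big_cons eqxx /= pJ undup_uniq.
  under eq_big_seq => i /neq -> do over.
  move=> <- //.
  + rewrite setIC; congr (P _).
    rewrite (_ : [set` p :: undup J] = [set p] `|` [set` undup J]); last first.
      by apply/seteqP; split=> i /=; rewrite inE => /predU1P.
    rewrite bigcap_setU bigcap_set1 eqxx.
    congr (_ `&` _).
    by apply: eq_bigcapr => i /= iJ; rewrite neq.
  + by move=> i; rewrite inE => /orP[/eqP ->//|]; rewrite mem_undup => /JE/ED.
  + move=> i; rewrite inE => /orP[/eqP ->|iJ]; first by rewrite eqxx.
    by rewrite neq//; move: iJ; rewrite mem_undup; exact: mC.
- move=> _; rewrite /m1 /= /mrestr /=; apply: (le_lt_trans (probability_le1 _ _)).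
    exact: measurableI.
  by rewrite ltry.
Qed.

End independence.

Section transfer.
Context {d d' : measure_display} {T : measurableType d} {T' : measurableType d'}.
Context {R : realType} (P : probability T R).

Lemma integral_independent (x y : {mfun T >-> T'}) (A : set T) (h : T' -> \bar R) :
  measurable A ->
  (forall B, measurable B -> P (A `&` x @^-1` B) = (P (x @^-1` B) * P A)%E) ->
  (forall B, measurable B -> distribution P x B = distribution P y B) ->
  measurable_fun setT h -> (forall t, (0 <= h t)%E) ->
  (\int[P]_(w in A) h (x w) = P A * \int[P]_w h (y w))%E.
Proof.
move=> mA indep xy mh h0.
have c0 : 0 <= fine (P A) by rewrite fine_ge0.
have cE : (fine (P A))%:E = P A by rewrite fineK// fin_num_measure.
have mhx : measurable_fun setT (h \o x) by exact: measurableT_comp.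
transitivity (\int[mrestr P mA]_w h (x w))%E.
  rewrite (eq_measure_integral (mrestr P mA)); last first.
    by move=> B mB BA; rewrite /= /mrestr setIidl.
  rewrite -[in RHS](setUv A) ge0_integral_setU//=.
  - rewrite [X in (_ + X)%E](eq_measure_integral mzero) ?integral_measure_zero ?adde0//.
    move=> B mB BA; rewrite /= /mrestr (_ : B `&` A = set0) ?measure0//.
    by apply/seteqP; split=> // w [/BA].
  - exact: measurableC.
  - by rewrite setUv.
  - exact/disj_setPCl.
rewrite -cE.
rewrite -(ge0_integral_pushforward (measurable_funPT x) _ measurableT)//.
rewrite -(@ge0_integral_distribution _ _ _ _ _ P y h)//.
rewrite -(ge0_integral_mscale (distribution P y) measurableT (NngNum c0))//.
apply: eq_measure_integral => B mB _.
rewrite /= /pushforward /mrestr /mscale /= cE setIC indep// muleC; congr (_ * _)%E.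
exact: xy.
Qed.

End transfer.

Section decoupling.
Context {d : measure_display} {T : measurableType d} {R : realType}.
Variables (P : probability T R) (G : set (set T)).
Hypothesis sGm : forall A, <<s G >> A -> measurable A.
Context {V : normedModType R}.
Variables (X : T -> V) (H : V -> T -> R) (b : V -> R).
Hypothesis sX : separably_measurable (X : g_sigma_algebraType G -> V).
Hypothesis H_ge0 : forall y w, 0 <= H y w.
Hypothesis mH : forall y, measurable_fun setT (H y).
Hypothesis cH : forall w, continuous (H ^~ w).
Hypothesis b_ge0 : forall y, 0 <= b y.
Hypothesis cb : continuous (b : V -> R^o).
Hypothesis H_le : forall y A, <<s G >> A ->
  (\int[P]_(w in A) (H y w)%:E <= (b y)%:E * P A)%E.

Lemma decoupling_index : exists (q : nat -> V) (N : nat -> T -> nat),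
  (forall j n, <<s G >> (N j @^-1` [set n])) /\
  forall j w, `|X w - q (N j w)| < j.+1%:R^-1 /\
              b (q (N j w)) <= b (X w) + j.+1%:R^-1.
Proof.
have [[q hq] mX] := sX; exists q.
have mb : measurable_fun setT (fun w : g_sigma_algebraType G => b (X w)).
  have := separably_measurable_norm (separably_measurable_comp cb sX).
  congr (measurable_fun _ _); apply/funext => w /=.
  by rewrite ger0_norm.
have /choice[N hN] : forall j, exists N : T -> nat,
    (forall n, <<s G >> (N @^-1` [set n])) /\
    forall w, [set w | `|X w - q (N w)| < j.+1%:R^-1 /\
                       b (q (N w)) <= b (X w) + j.+1%:R^-1] w.
  move=> j; have j0 : 0 < j.+1%:R^-1 :> R by rewrite invr_gt0.
  apply: (@measurable_selection _ (g_sigma_algebraType G)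
     (fun n => [set w | `|X w - q n| < j.+1%:R^-1 /\
                        b (q n) <= b (X w) + j.+1%:R^-1])).
    move=> n; rewrite (_ : mkset _ =
        (setT `&` (fun w => `|X w - q n|) @^-1` `]-oo, j.+1%:R^-1[)
        `&` (setT `&` (fun w => b (X w)) @^-1` `[b (q n) - j.+1%:R^-1, +oo[)).
      by apply: measurableI; [exact: mX|exact: mb].
    apply/seteqP; split => w; rewrite /= !in_itv/= andbT lerBlDr.
      by move=> [? ?].
    by move=> [[_ ?] [_ ?]].
  move=> w.
  have cbX : (b : V -> R^o) y @[y --> X w] --> (b (X w) : R^o) by exact: cb.
  have /cvgrPdist_le/(_ _ j0)/nbhs_ballP[e /= e0 he] := cbX.
  have me : 0 < Num.min e j.+1%:R^-1 by rewrite lt_min e0.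
  have [n] := hq w _ me; rewrite lt_min => /andP[Xe Xj].
  exists n; split => //.
  have : `|b (X w) - b (q n)| <= j.+1%:R^-1 by apply: he; rewrite -ball_normE.
  by rewrite distrC ler_norml => /andP[_]; rewrite lerBlDl.
by exists N; split=> [j n|j w]; [exact: (hN j).1|exact: (hN j).2].
Qed.

Lemma decoupling :
  (\int[P]_w (H (X w) w)%:E <= \int[P]_w (b (X w))%:E)%E.
Proof.
have [q [N [mN XN]]] := decoupling_index.
have mNd j n : measurable (N j @^-1` [set n]) by apply: sGm; exact: mN.
have mbX : measurable_fun setT (fun w : T => b (X w)).
  have := separably_measurable_norm (separably_measurable_comp cb sX).
  move=> mb _ B mB; apply: sGm.
  have := mb measurableT B mB; congr (<<s G >> _).
  by apply/seteqP; split => w; rewrite /= ger0_norm.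
have mHj j : measurable_fun setT (fun w => H (q (N j w)) w).
  move=> _ B mB; rewrite setTI.
  apply: (preimage_index_measurable (A := fun n => H (q n) @^-1` B)) => // n.
  by rewrite -[X in measurable X]setTI; exact: mH.
have mbj j : measurable_fun setT (fun w => b (q (N j w))).
  move=> _ B mB; rewrite setTI.
  apply: (preimage_index_measurable (A := fun n => (fun _ => b (q n)) @^-1` B)) => // n.
  by rewrite -[X in measurable X]setTI; exact: measurable_cst.
have Hj j : (\int[P]_w (H (q (N j w)) w)%:E
             <= \int[P]_w (b (X w))%:E + j.+1%:R^-1%:E)%E.
  have j0 : 0 <= j.+1%:R^-1 :> R by rewrite invr_ge0.
  apply: (@le_trans _ _ (\int[P]_w (b (q (N j w)))%:E)%E).
    have cover : [set: T] = \bigcup_n (N j @^-1` [set n]).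
      by apply/esym/seteqP; split => // w _; exists (N j w).
    have tN : trivIset setT (fun n => N j @^-1` [set n]).
      apply/trivIsetP => a c _ _ /eqP ac; apply/seteqP; split=> // w [/= Na Nc].
      by apply: ac; rewrite -Na.
    rewrite cover !ge0_integral_bigcup -?cover//; last 4 first.
    - exact/measurable_EFinP.
    - by move=> w _; rewrite lee_fin.
    - exact/measurable_EFinP.
    - by move=> w _; rewrite lee_fin.
    apply: lee_nneseries => [n _ _|n _].
      by apply: integral_ge0 => w _; rewrite lee_fin.
    rewrite (eq_integral (fun w => (H (q n) w)%:E)); last first.
      by move=> w; rewrite inE /= => ->.
    apply: le_trans (H_le (q n) (mN j n)) _.
    rewrite -integral_cst//.
    apply: ge0_le_integral => //.
    - by move=> w _; rewrite lee_fin.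
    - by apply: measurable_funTS; exact/measurable_EFinP.
    - by move=> w /= ->.
  rewrite -[j.+1%:R^-1%:E]mule1 -(probability_setT P) -integral_cst//.
  rewrite -ge0_integralD//; last 2 first.
  - by move=> w _; rewrite lee_fin.
  - exact/measurable_EFinP.
  apply: ge0_le_integral => //.
  - by move=> w _; rewrite lee_fin.
  - exact/measurable_EFinP.
  - by apply: emeasurable_funD => //; exact/measurable_EFinP.
  - by move=> w _; rewrite -EFinD lee_fin; exact: (XN j w).2.
rewrite (eq_integral (fun w => limn_einf (fun j => (H (q (N j w)) w)%:E))); last first.
  move=> w _; apply/esym.
  have Hcvg : (H (q (N j w)) w)%:E @[j --> \oo] --> (H (X w) w)%:E.
    apply: cvg_EFin; first exact: nearW.
    apply: (continuous_cvg _ (@cH w (X w))).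
    by apply: cvg_inv_succ => j; exact: (XN j w).1.
  by rewrite is_cvg_limn_einfE; [exact/cvg_lim|apply/cvg_ex; eexists; exact: Hcvg].
apply: le_trans (fatou _ _ _ _) _ => //.
- by move=> j; exact/measurable_EFinP.
- by move=> j w _; rewrite lee_fin.
rewrite limn_einf_lim; apply/lee_addgt0Pr => e e0.
apply: lime_le; first exact: is_cvg_einfs.
near=> j; apply: (@le_trans _ _ (\int[P]_w (H (q (N j w)) w)%:E)%E).
  by apply: ereal_inf_lbound; exists j => /=.
apply: le_trans (Hj j) _; rewrite leeD2l// lee_fin ltW//.
near: j; exact: (near_infty_natSinv_lt (PosNum e0)).
Unshelve. all: by end_near. Qed.

End decoupling.

(** * Noise of one batch *)

Section bochner.
Context {d : measure_display} {T : measurableType d} {R : realType}.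
Variable P : probability T R.
Context {U : normedModType R} (dot : {dot U for idfun}).
Hypothesis hilbert : norm_from_dot dot.

Lemma strongly_measurableT_separably (X : T -> U) :
  strongly_measurable setT X -> separably_measurable X.
Proof. by move=> sX; apply: (strongly_measurable_comp (x := id) sX). Qed.

Lemma measurable_dot (X Y : T -> U) : separably_measurable X ->
  separably_measurable Y -> measurable_fun setT (fun w => dot (X w) (Y w)).
Proof.
move=> sX sY.
rewrite (_ : (fun _ => _) = (fun w => 2^-1 *
    (`|X w + Y w| ^+ 2 - `|X w| ^+ 2 - `|Y w| ^+ 2))).
  apply: measurable_funM => //; apply: measurable_funB; first apply: measurable_funB.
  - by apply: measurable_funX; apply/separably_measurable_norm/separably_measurableD.
  - by apply: measurable_funX; exact: separably_measurable_norm.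
  - by apply: measurable_funX; exact: separably_measurable_norm.
by apply/funext => w; rewrite (normD_sq hilbert); field.
Qed.

Lemma simple_dot_expectation (s : T -> U) (y : U) : simple_vector_fun s ->
  P.-integrable setT (fun w => (dot y (s w))%:E) /\
  (\int[P]_w (dot y (s w))%:E)%E = (dot y (simple_expectation P s))%:E.
Proof.
move=> [/finite_seqP[r0 r0E] ms].
have [r ur rE] : exists2 r : seq U, uniq r & range s = [set` r].
  by exists (undup r0); rewrite ?undup_uniq// r0E; apply/seteqP; split=> x /=; rewrite mem_undup.
have sE : (fun w => (dot y (s w))%:E) = (fun w => \sum_(z <- r)
    ((dot y z)%:E * (\1_(s @^-1` [set z]) w)%:E))%E.
  apply/funext => w; have sr : s w \in r by have : range s (s w) by [exists w]; rewrite rE.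
  rewrite (bigD1_seq (s w))//= indicE mem_set// mule1 big1 ?adde0// => z zs.
  by rewrite indicE memNset ?mule0//= => /esym; exact/eqP.
have iz z : P.-integrable setT (fun w => (dot y z)%:E * (\1_(s @^-1` [set z]) w)%:E)%E.
  by apply: integrableZl => //; apply: integrable_indic.
rewrite sE; split; first by apply: integrable_sum => // z _; exact: iz.
rewrite integral_sum// /simple_expectation rE -fsbig_seq//.
rewrite (big_morph (dot y) (dotDr dot y) (dot0r dot y)) -sumEFin.
apply: eq_bigr => z _.
rewrite integralZl//; last exact: integrable_indic.
rewrite integral_indic// setIT (dotZr dot) mulrC EFinM fineK//.
exact: fin_num_measure.
Qed.

Lemma square_integrable_dot (Z : T -> U) (y : U) : separably_measurable Z ->
  P.-integrable setT (fun w => (`|Z w| ^+ 2)%:E) ->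
  P.-integrable setT (fun w => (dot y (Z w))%:E).
Proof.
move=> sZ iZ.
have iyZ : P.-integrable setT (fun w => (`|y| ^+ 2)%:E + (`|Z w| ^+ 2)%:E)%E.
  by apply: integrableD => //; exact: finite_measure_integrable_cst.
apply: le_integrable iyZ => //.
  apply/measurable_EFinP; apply: measurable_dot => //.
  exact: separably_measurable_cst.
move=> w _; rewrite -EFinD !abse_EFin lee_fin [leRHS]ger0_norm ?addr_ge0 ?sqr_ge0//.
have H1 := Cauchy_Schwarz_dot hilbert y (Z w).
have H2 := Cauchy_Schwarz_dotN hilbert y (Z w).
have : 0 <= (`|y| - `|Z w|) ^+ 2 by rewrite sqr_ge0.
have yZ : 0 <= `|y| * `|Z w| by rewrite mulr_ge0.
rewrite ler_norml sqrrB => H3; apply/andP; split; lra.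
Qed.

Lemma bochner_centered_dot (X : T -> U) (e y : U) :
  is_bochner_expectation P X e ->
  P.-integrable setT (fun w => (`|X w - e| ^+ 2)%:E) ->
  (\int[P]_w (dot y (X w - e)%R)%:E = 0)%E.
Proof.
move=> [/strongly_measurableT_separably sX [s [ss sint scvg]]] i2.
have sXe : separably_measurable (fun w => X w - e).
  by apply: separably_measurableB => //; exact: separably_measurable_cst.
have iXe := square_integrable_dot y sXe i2.
have [c cE] : exists c, (\int[P]_w (dot y (X w - e)%R)%:E = c%:E)%E.
  by exists (fine (\int[P]_w (dot y (X w - e)%R)%:E)%E); rewrite fineK// integrable_fin_num.
rewrite cE; congr (_%:E); apply/eqP; rewrite -normr_le0.
apply: (@le_of_forall_small _ _ _ (2 * `|y|)) => t /andP[t0 _]; rewrite add0r.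
have /fine_cvgP[sfin /cvgrPdist_lt/(_ _ t0) slt] := sint.
have /cvgrPdist_lt/(_ _ t0) scvg' := scvg.
have [j _ /(_ j (leqnn j)) [[/= jfin jlt] jcvg]] := filterI (filterI sfin slt) scvg'.
have sXs : separably_measurable (fun w => X w - s j w).
  apply: separably_measurableB => //.
  exact: simple_vector_fun_separably_measurable.
have [isj sjE] := simple_dot_expectation y (ss j).
have idiff : P.-integrable setT (fun w => (dot y (X w - s j w))%:E).
  have := integrableB measurableT iXe (integrableB measurableT isj
    (finite_measure_integrable_cst P (dot y e) measurableT)).
  apply: eq_integrable => // w _; rewrite /= -!EFinB; congr (_%:E).
  by rewrite -!(dotBr dot) opprB addrA subrK.
have cE' : c%:E = (\int[P]_w (dot y (X w - s j w))%:E
                  + (dot y (simple_expectation P (s j) - e))%:E)%E.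
  rewrite -cE (dotBr dot) EFinB -sjE.
  rewrite -[X in (_ - X)%E]mule1 -(probability_setT P) -integral_cst//.
  rewrite -integralB//; last exact: finite_measure_integrable_cst.
  rewrite -integralD//; last by apply: integrableB => //; exact: finite_measure_integrable_cst.
  apply: eq_integral => w _; rewrite /= -EFinB -EFinD; congr (_%:E).
  by rewrite -!(dotBr dot) -(dotDr dot) addrA subrK.
have b1 : (`| \int[P]_w (dot y (X w - s j w))%:E | <= (`|y| * t)%:E)%E.
  apply: le_trans (le_abse_integral P measurableT _) _.
    by case/integrableP: idiff.
  apply: (@le_trans _ _ (\int[P]_w (`|y|%:E * `|X w - s j w|%:E))%E).
    apply: ge0_le_integral => //.
    - by apply: measurableT_comp => //; case/integrableP: idiff.
    - apply: measurable_funeM; apply/measurable_EFinP.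
      exact: separably_measurable_norm.
    - move=> w _; rewrite abse_EFin -EFinM lee_fin ler_norml.
      by rewrite (Cauchy_Schwarz_dot hilbert) (Cauchy_Schwarz_dotN hilbert).
  rewrite ge0_integralZl//; last first.
    by apply/measurable_EFinP; exact: separably_measurable_norm.
  rewrite -(fineK jfin) -EFinM lee_fin ler_wpM2l//.
  by move: jlt; rewrite /= sub0r normrN => jlt; apply: le_trans (ler_norm _) (ltW jlt).
have b2 : `|dot y (simple_expectation P (s j) - e)| <= `|y| * t.
  have : `|y| * `|simple_expectation P (s j) - e| <= `|y| * t.
    by rewrite ler_wpM2l// distrC ltW.
  apply: le_trans; rewrite ler_norml.
  by rewrite (Cauchy_Schwarz_dot hilbert) (Cauchy_Schwarz_dotN hilbert).
have ifin := integrable_fin_num measurableT idiff.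
move: cE' b1; rewrite -(fineK ifin) -EFinD abse_EFin lee_fin => -[->] b1.
by apply: le_trans (ler_normD _ _) _; lra.
Qed.

Lemma bochner_variance_shift (X : T -> U) (e y : U) (v : R) :
  is_bochner_expectation P X e ->
  (\int[P]_w (`|X w - e| ^+ 2)%:E <= v%:E)%E ->
  (\int[P]_w (`|y + (X w - e)| ^+ 2)%:E <= (`|y| ^+ 2 + v)%:E)%E.
Proof.
move=> bX vX.
have [/strongly_measurableT_separably sX _] := bX.
have sXe : separably_measurable (fun w => X w - e).
  by apply: separably_measurableB => //; exact: separably_measurable_cst.
have i2 : P.-integrable setT (fun w => (`|X w - e| ^+ 2)%:E).
  apply/integrableP; split.
    apply/measurable_EFinP; apply: measurable_funX.
    exact: separably_measurable_norm.
  under eq_integral do rewrite abse_EFin ger0_norm ?sqr_ge0//.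
  by apply: le_lt_trans vX _; rewrite ltry.
have id := square_integrable_dot y sXe i2.
rewrite (eq_integral (fun w => (`|y| ^+ 2)%:E +
   (2%:E * (dot y (X w - e))%:E + (`|X w - e| ^+ 2)%:E))%E); last first.
  by move=> w _; rewrite (normD_sq hilbert) -EFinM -!EFinD addrA.
have i2d : P.-integrable setT (fun w => 2%:E * (dot y (X w - e))%:E)%E.
  exact: integrableZl.
rewrite integralD//; last 2 first.
- exact: finite_measure_integrable_cst.
- exact: integrableD.
rewrite integralD// integralZl// (bochner_centered_dot y bX i2) mule0 add0e.
rewrite integral_cst// [X in (_ * X)%E]probability_setT mule1 EFinD.
exact: leeD2l.
Qed.

End bochner.

Section stochastic_gradient.
Context {R : realType} {U : normedModType R} (dot : {dot U for idfun}).
Hypothesis hilbert : norm_from_dot dot.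
Context {d d' : measure_display} {Omega : measurableType d} {S : measurableType d'}.
Variables (P : probability Omega R) (Xi : set S) (xi : {mfun Omega >-> S}).
Variables (gradF : U -> S -> U) (gradf : U -> U) (varrho : R).
Hypothesis xi_in_Xi : forall w, Xi (xi w).
Hypothesis gradF_measurable : forall u, strongly_measurable Xi (gradF u).
Hypothesis gradF_continuous : forall t, Xi t -> continuous (gradF ^~ t).
Hypothesis gradf_continuous : continuous gradf.
Hypothesis gradF_unbiased : forall u,
  is_bochner_expectation P (fun w => gradF u (xi w)) (gradf u).
Hypothesis gradF_variance : forall u,
  (\int[P]_w (`|gradF u (xi w) - gradf u| ^+ 2)%:E <= (varrho ^+ 2)%:E)%E.

Definition centered_grad (t : S) (u : U) : U := gradF u t - gradf u.

Lemma centered_grad_continuous t : Xi t -> continuous (centered_grad t).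
Proof.
by move=> Xt u; apply: cvgB; [exact: gradF_continuous|exact: gradf_continuous].
Qed.

Lemma centered_grad_measurable {d0 : measure_display} {T : measurableType d0}
    (x : T -> S) (V : T -> U) :
  measurable_fun setT x -> (forall w, Xi (x w)) -> separably_measurable V ->
  separably_measurable (fun w => centered_grad (x w) (V w)).
Proof.
move=> mx Xx sV.
apply: (separably_measurable_caratheodory (H := fun u w => centered_grad (x w) u)) => //.
  by move=> w; exact: centered_grad_continuous.
move=> u; apply: separably_measurableB; last exact: separably_measurable_cst.
exact: strongly_measurable_comp (gradF_measurable u) mx Xx.
Qed.

Lemma shifted_sample_integral_le (x : {mfun Omega >-> S}) (A : set Omega) (y u : U) :
  measurable A -> (forall w, Xi (x w)) ->
  (forall B, measurable B -> P (A `&` x @^-1` B) = (P (x @^-1` B) * P A)%E) ->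
  (forall B, measurable B -> distribution P x B = distribution P xi B) ->
  (\int[P]_(w in A) (`|y + centered_grad (x w) u| ^+ 2)%:E
    <= (`|y| ^+ 2 + varrho ^+ 2)%:E * P A)%E.
Proof.
move=> mA Xx indep xxi.
have [s [ss hs]] := gradF_measurable u.
pose h t := (`| limn_esup (fun j => (`|y + (s j t - gradf u)| ^+ 2)%:E) |)%E.
have hE t : Xi t -> h t = (`|y + centered_grad t u| ^+ 2)%:E.
  move=> Xt; rewrite /h.
  have hcvg : (`|y + (s j t - gradf u)| ^+ 2)%:E @[j --> \oo] -->
      (`|y + centered_grad t u| ^+ 2)%:E.
    apply: cvg_EFin; first exact: nearW.
    apply: cvgM; apply: cvg_norm; apply: cvgD; try exact: cvg_cst;
      by apply: cvgB; [exact: hs|exact: cvg_cst].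
  rewrite is_cvg_limn_esupE; last by apply/cvg_ex; eexists; exact: hcvg.
  by rewrite (cvg_lim _ hcvg)// abse_EFin ger0_norm// sqr_ge0.
have mh : measurable_fun setT h.
  apply: measurableT_comp => //; apply: measurable_fun_limn_esup => j.
  apply/measurable_EFinP; apply: measurable_funX; apply: separably_measurable_norm.
  apply: separably_measurableD; first exact: separably_measurable_cst.
  apply: separably_measurableB; last exact: separably_measurable_cst.
  exact: simple_vector_fun_separably_measurable.
rewrite (eq_integral (fun w => h (x w))); last by move=> w _; rewrite hE.
rewrite (integral_independent (y := xi) mA)//; last by move=> t; exact: abse_ge0.
rewrite muleC lee_wpmul2r//.
rewrite (eq_integral (fun w => (`|y + centered_grad (xi w) u| ^+ 2)%:E)); last first.
  by move=> w _; rewrite hE.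
exact: (bochner_variance_shift hilbert).
Qed.

Lemma sample_step (G : set (set Omega)) (x : {mfun Omega >-> S}) (Y V : Omega -> U) :
  (forall A, <<s G >> A -> measurable A) -> (forall w, Xi (x w)) ->
  (forall A B, <<s G >> A -> measurable B ->
     P (A `&` x @^-1` B) = (P (x @^-1` B) * P A)%E) ->
  (forall B, measurable B -> distribution P x B = distribution P xi B) ->
  separably_measurable (Y : g_sigma_algebraType G -> U) ->
  separably_measurable (V : g_sigma_algebraType G -> U) ->
  (\int[P]_w (`|Y w + centered_grad (x w) (V w)| ^+ 2)%:E
    <= \int[P]_w (`|Y w| ^+ 2 + varrho ^+ 2)%:E)%E.
Proof.
move=> sGm Xx indep xxi sY sV.
apply: (decoupling sGm (X := fun w => (Y w, V w))
  (H := fun p w => `|p.1 + centered_grad (x w) p.2| ^+ 2)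
  (b := fun p => `|p.1| ^+ 2 + varrho ^+ 2)).
- exact: separably_measurable_pair.
- by move=> y w; rewrite sqr_ge0.
- move=> y; apply: measurable_funX; apply: separably_measurable_norm.
  apply: separably_measurableD; first exact: separably_measurable_cst.
  by apply: centered_grad_measurable => //; exact: separably_measurable_cst.
- move=> w p; apply: cvgM; apply: cvg_norm; apply: cvgD; try exact: cvg_fst;
    by apply: (cvg_comp _ _ cvg_snd); exact: centered_grad_continuous.
- by move=> y; rewrite addr_ge0 ?sqr_ge0.
- move=> p; apply: cvgD; last exact: cvg_cst.
  by apply: cvgM; apply: cvg_norm; exact: cvg_fst.
- move=> y A sA; apply: shifted_sample_integral_le => //; first exact: sGm.
  by move=> B; exact: indep.
Qed.

Variables (m : nat -> nat) (xs : nat -> nat -> {mfun Omega >-> S}).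
Hypothesis xs_iid : iid_batches P Xi xi m xs.

Let drawn : set (nat * nat) := [set p | (p.2 < m p.1)%N].

Definition other_samples (k i : nat) : set (set Omega) :=
  cylinders (fun p : nat * nat => xs p.1 p.2) (drawn `\` [set (k, i)]).

Lemma other_samples_measurable k i l j : (j < m l)%N -> (l, j) != (k, i) ->
  measurable_fun setT (xs l j : g_sigma_algebraType (other_samples k i) -> S).
Proof.
move=> jl ne _ B mB; rewrite setTI.
apply: (@cylinders_preimage _ _ _ _ _ (fun p : nat * nat => xs p.1 p.2) _ (l, j)) => //.
by split => //= /eqP; exact/negP.
Qed.

Lemma batch_bound k (Y V : Omega -> U) (n : nat) :
  (forall i, (i < m k)%N ->
    separably_measurable (Y : g_sigma_algebraType (other_samples k i) -> U) /\
    separably_measurable (V : g_sigma_algebraType (other_samples k i) -> U)) ->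
  (n <= m k)%N ->
  (\int[P]_w (`|Y w + \sum_(i < n) centered_grad (xs k i w) (V w)| ^+ 2)%:E
   <= \int[P]_w (`|Y w| ^+ 2 + n%:R * varrho ^+ 2)%:E)%E.
Proof.
move=> sYV; have [xsXi xsdist xsind] := xs_iid.
have sGm i A : <<s other_samples k i >> A -> measurable A.
  exact: sigma_cylinders_measurable.
elim: n => [_|n IH nm].
  rewrite le_eqVlt; apply/orP; left; apply/eqP; apply: eq_integral => w _.
  by rewrite big_ord0 addr0 mul0r addr0.
have sum_meas i : (i < m k)%N -> (n <= i)%N ->
    separably_measurable (fun w : g_sigma_algebraType (other_samples k i) =>
      Y w + \sum_(j < n) centered_grad (xs k j w) (V w)).
  move=> im ni; have [sY sV] := sYV i im.
  apply: separably_measurableD => //; apply: separably_measurable_sum => j.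
  have jm : (j < m k)%N by apply: leq_ltn_trans im; apply: leq_trans ni; exact: ltnW.
  apply: centered_grad_measurable => //; last by move=> w; exact: xsXi.
  apply: other_samples_measurable => //.
  by apply/eqP => -[ji]; move: (ltn_ord j); rewrite ji ltnNge ni.
have [sY sV] := sYV n nm.
under eq_integral do rewrite big_ord_recr /= addrA.
apply: le_trans (sample_step (G := other_samples k n) _ _ _ _ _ _) _ => //.
- exact: sGm.
- by move=> w; exact: xsXi.
- move=> A B sA mB.
  apply: (independent_cylinders (p := (k, n)) xsind _ _ _ sA mB) => //.
  by case=> _ H; exact: H.
- by move=> B mB; exact: xsdist.
- exact: sum_meas.
have msq (Z : Omega -> U) :
    separably_measurable (Z : g_sigma_algebraType (other_samples k n) -> U) ->
    measurable_fun setT (fun w => (`|Z w| ^+ 2)%:E).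
  move=> sZ; apply/measurable_EFinP; apply: measurable_funX.
  exact/separably_measurable_norm/(separably_measurable_sub (@sGm n)).
have addc (Z : Omega -> U) (r : R) : 0 <= r ->
    separably_measurable (Z : g_sigma_algebraType (other_samples k n) -> U) ->
    (\int[P]_w (`|Z w| ^+ 2 + r)%:E = \int[P]_w (`|Z w| ^+ 2)%:E + r%:E)%E.
  move=> r0 sZ.
  rewrite -[in RHS](mule1 r%:E) -(probability_setT P) -integral_cst//.
  by rewrite -ge0_integralD//; exact: msq.
have v0 : 0 <= varrho ^+ 2 by rewrite sqr_ge0.
rewrite addc//; last exact: sum_meas.
rewrite addc//; last by rewrite mulr_ge0.
have := IH (ltnW nm); rewrite addc//; last by rewrite mulr_ge0.
move=> {}IH; apply: le_trans (leeD2r _ IH) _.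
by rewrite -addeA -EFinD -natr1 mulrDl mul1r.
Qed.

(* Completing the square turns the noise into the squared norm of a sum started
   at [Y], which [batch_bound] controls. *)
Lemma noise_expectation k (V : Omega -> U) (x : U) (t phi nu : R) :
  (0 < m k)%N -> 0 < phi ->
  separably_measurable V ->
  (forall i, (i < m k)%N ->
    separably_measurable (V : g_sigma_algebraType (other_samples k i) -> U)) ->
  (forall w, `|V w - x| ^+ 2 <= nu) ->
  let delta w := (m k)%:R^-1 *: \sum_(i < m k) gradF (V w) (xs k i w)
                 - gradf (V w) in
  let noise w := - t * dot (delta w) (V w - x) + phi / 2 * `|delta w| ^+ 2 in
  P.-integrable setT (fun w => (noise w)%:E) /\
  (\int[P]_w (noise w)%:E <= (phi * varrho ^+ 2 / (2 * (m k)%:R))%:E)%E.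
Proof.
move=> mk0 phi0 sV sVi Vnu delta noise.
have M0 : 0 < (m k)%:R :> R by rewrite ltr0n.
set M := (m k)%:R in M0 *.
have Mn : M != 0 by rewrite gt_eqF.
have phin : phi != 0 by rewrite gt_eqF.
pose Y w := - (t * M / phi) *: (V w - x).
pose Z w := Y w + \sum_(i < m k) centered_grad (xs k i w) (V w).
have deltaE w : delta w = M^-1 *: \sum_(i < m k) centered_grad (xs k i w) (V w).
  rewrite /delta /centered_grad sumrB scalerBr; congr (_ - _).
  by rewrite sumr_const card_ord -scaler_nat scalerA mulVf// scale1r.
have YE w : phi / (2 * M ^+ 2) * `|Y w| ^+ 2 = t ^+ 2 / (2 * phi) * `|V w - x| ^+ 2.
  by rewrite /Y normZ_sq; field; rewrite phin Mn.
have noiseE w : noise w = phi / (2 * M ^+ 2) * `|Z w| ^+ 2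
                          - t ^+ 2 / (2 * phi) * `|V w - x| ^+ 2.
  rewrite /Z (normD_sq hilbert (Y w)) -YE.
  have -> (c y D s2 : R) : c * (y + 2 * D + s2) - c * y = 2 * c * D + c * s2 by ring.
  rewrite /noise deltaE normZ_sq (dotZl dot) /Y (dotZl dot).
  by rewrite (dot_sym dot (V w - x)); field; rewrite phin Mn.
have [xsXi _ _] := xs_iid.
have sVx : separably_measurable (fun w => V w - x).
  by apply: separably_measurableB => //; exact: separably_measurable_cst.
have sY : separably_measurable Y by exact: separably_measurableZ.
have sZ : separably_measurable Z.
  apply: separably_measurableD => //; apply: separably_measurable_sum => i.
  by apply: centered_grad_measurable => // w; exact: xsXi.
have msq (X : Omega -> U) (r : R) : separably_measurable X ->
    measurable_fun setT (fun w => (r * `|X w| ^+ 2)%:E).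
  move=> sX; apply/measurable_EFinP; apply: measurable_funM => //.
  by apply: measurable_funX; exact: separably_measurable_norm.
set B := fun w => t ^+ 2 / (2 * phi) * `|V w - x| ^+ 2 in noiseE.
set A := fun w => phi / (2 * M ^+ 2) * `|Z w| ^+ 2 in noiseE.
have cB : 0 <= t ^+ 2 / (2 * phi).
  by rewrite divr_ge0 ?sqr_ge0// mulr_ge0// ltW.
have cA : 0 <= phi / (2 * M ^+ 2).
  by rewrite divr_ge0 ?mulr_ge0 ?sqr_ge0// ltW.
have iB : P.-integrable setT (fun w => (B w)%:E).
  apply: (le_integrable measurableT _ _
    (finite_measure_integrable_cst P (t ^+ 2 / (2 * phi) * nu) measurableT)).
    exact: msq.
  move=> w _; rewrite !abse_EFin lee_fin /B.
  rewrite [leLHS]ger0_norm; last by rewrite mulr_ge0 ?sqr_ge0.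
  by apply: le_trans (ler_norm _); exact: ler_wpM2l.
have leA : (\int[P]_w (A w)%:E <=
    \int[P]_w (B w)%:E + (phi * varrho ^+ 2 / (2 * M))%:E)%E.
  have sYV i : (i < m k)%N ->
    separably_measurable (Y : g_sigma_algebraType (other_samples k i) -> U) /\
    separably_measurable (V : g_sigma_algebraType (other_samples k i) -> U).
    move=> /sVi sVi'; split=> //; apply: separably_measurableZ.
    by apply: separably_measurableB => //; exact: separably_measurable_cst.
  have := batch_bound sYV (leqnn _).
  move=> /(lee_wpmul2l (x := (phi / (2 * M ^+ 2))%:E)).
  rewrite lee_fin => /(_ cA).
  rewrite -!ge0_integralZl//; last 3 first.
  - apply/measurable_EFinP; apply: measurable_funD; last exact: measurable_cst.
    by apply: measurable_funX; exact: (separably_measurable_norm sY).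
  - move=> w _; rewrite lee_fin; apply: addr_ge0; first exact: sqr_ge0.
    by apply: mulr_ge0 (sqr_ge0 _); exact: ltW.
  - apply/measurable_EFinP; apply: measurable_funX.
    exact: separably_measurable_norm.
  under [X in (X <= _)%E]eq_integral do rewrite -EFinM.
  move=> /le_trans; apply.
  rewrite -[in leRHS](mule1 (phi * _ / _)%:E) -(probability_setT P) -integral_cst//.
  rewrite -ge0_integralD//; last 3 first.
  - by move=> w _; rewrite lee_fin; exact: mulr_ge0 cB (sqr_ge0 _).
  - exact: msq.
  - move=> w _; rewrite /= lee_fin.
    exact: divr_ge0 (mulr_ge0 (ltW phi0) (sqr_ge0 _)) (mulr_ge0 (ler0n _ 2) (ltW M0)).
  rewrite le_eqVlt; apply/orP; left; apply/eqP; apply: eq_integral => w _.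
  by rewrite -EFinM -EFinD /B -YE; congr (_%:E); field; rewrite Mn.
have iA : P.-integrable setT (fun w => (A w)%:E).
  apply/integrableP; split; first exact: msq.
  rewrite (eq_integral (fun w => (A w)%:E)) => [|w _]; last first.
    by rewrite abse_EFin ger0_norm//; exact: mulr_ge0 cA (sqr_ge0 _).
  apply: le_lt_trans leA _; rewrite -(fineK (integrable_fin_num measurableT iB)).
  by rewrite -EFinD ltry.
rewrite (_ : (fun w => (noise w)%:E) = (fun w => (A w)%:E - (B w)%:E)%E); last first.
  by apply/funext => w; rewrite noiseE EFinB.
split; first exact: integrableB.
rewrite integralB// leeBlDr ?(integrable_fin_num measurableT iB)// addeC.
exact: leA.
Qed.

End stochastic_gradient.

(** * Measurability of the iterates and conclusion *)

Section iterates_measurable.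
Context {R : realType} {U : normedModType R} (dot : {dot U for idfun}).
Hypothesis hilbert : norm_from_dot dot.
Context {d d' : measure_display} {T : measurableType d} {S : measurableType d'}.
Variables (Uad : set U) (g : U -> \bar R) (Xi : set S) (gradF : U -> S -> U).
Hypothesis Uad_convex : convex_set Uad.
Hypotheses (g_proper : proper_function g) (g_convex : econvex_function g).
Hypothesis gradF_measurable : forall u, strongly_measurable Xi (gradF u).
Hypothesis gradF_continuous : forall t, Xi t -> continuous (gradF ^~ t).
Variables (mu : R) (rho eta theta : nat -> R) (m : nat -> nat).
Hypotheses (rho_gt0 : forall k, 0 < rho k) (eta_gt0 : forall k, 0 < eta k).
Variables (x : nat -> nat -> T -> S) (u0 z0 lam0 : U).
Hypothesis x_in_Xi : forall k i w, (i < m k)%N -> Xi (x k i w).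
Variables (u z v s psi lam : nat -> T -> U).
Hypothesis iterates : forall w, sadmm_iterates dot Uad g gradF mu rho eta theta m
  (fun k i => x k i w) u0 z0 lam0
  (u ^~ w) (z ^~ w) (v ^~ w) (s ^~ w) (psi ^~ w) (lam ^~ w).

Let combine_measurable (r1 r2 : R) (V1 V2 B : T -> U) :
  separably_measurable V1 -> separably_measurable V2 -> separably_measurable B ->
  separably_measurable (fun w => r1 *: V1 w + r2 *: V2 w - B w).
Proof.
move=> sV1 sV2 sB; apply: separably_measurableB => //.
by apply: separably_measurableD; exact: separably_measurableZ.
Qed.

Lemma s_measurable k : separably_measurable (v k) -> separably_measurable (lam k) ->
  separably_measurable (s k.+1).
Proof.
move=> sv sl.
have sX := @combine_measurable (rho k) 0 (v k) (fun=> 0) (lam k) sv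
  (separably_measurable_cst 0) sl.
apply: (separably_measurable_lipschitz (C := (rho k + 0)^-1) _ sX) => w w'.
have [gs sP] := argmin_proper hilbert g_proper g_convex (sadmm_s (iterates w) k).
have [gs' sP'] := argmin_proper hilbert g_proper g_convex (sadmm_s (iterates w') k).
apply: (quadratic_argmin_nonexpansive hilbert _ (sP _ gs') (sP' _ gs)).
by rewrite addr0.
Qed.

Lemma v_measurable k : (forall i, (i < m k)%N -> measurable_fun setT (x k i)) ->
  separably_measurable (v k) -> separably_measurable (lam k) ->
  separably_measurable (v k.+1).
Proof.
move=> mx sv sl.
pose G w := (m k)%:R^-1 *: \sum_(i < m k) gradF (v k w) (x k i w).
have sG : separably_measurable G.
  apply: separably_measurableZ; apply: separably_measurable_sum => i.
  apply: (separably_measurable_caratheodory (H := fun y w => gradF y (x k i w))) => //.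
    by move=> w; apply: gradF_continuous; exact: x_in_Xi.
  move=> y; apply: (strongly_measurable_comp (gradF_measurable y) (mx i _)) => // w.
  exact: x_in_Xi.
have sX := @combine_measurable (rho k) (eta k) (s k.+1) (v k) (fun w => G w - lam k w)
  (s_measurable sv sl) sv (separably_measurableB sG sl).
apply: (separably_measurable_lipschitz (C := (rho k + eta k)^-1) _ sX) => w w'.
have vA w1 : Uad (v k.+1 w1) by case: (sadmm_v (iterates w1) k).
have vP := argmin_convex_set hilbert Uad_convex (sadmm_v (iterates w) k) (vA w').
have vP' := argmin_convex_set hilbert Uad_convex (sadmm_v (iterates w') k) (vA w).
apply: (quadratic_argmin_nonexpansive hilbert _ vP vP').
by rewrite addr_gt0.
Qed.

Lemma iterates_measurable n :
  (forall k i, (k < n)%N -> (i < m k)%N -> measurable_fun setT (x k i)) ->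
  [/\ separably_measurable (u n), separably_measurable (z n),
      separably_measurable (v n), separably_measurable (psi n)
    & separably_measurable (lam n)].
Proof.
have cst0 (X : T -> U) y : (forall w, X w = y) -> separably_measurable X.
  move=> Xy; rewrite (_ : X = fun=> y); first exact: separably_measurable_cst.
  exact/funext.
elim: n => [_|n IH mx].
  split.
  - by apply: (@cst0 _ u0) => w; exact: sadmm_u0 (iterates w).
  - by apply: (@cst0 _ z0) => w; exact: sadmm_z0 (iterates w).
  - by apply: (@cst0 _ u0) => w; exact: sadmm_v0 (iterates w).
  - by apply: (@cst0 _ lam0) => w; exact: sadmm_psi0 (iterates w).
  - by apply: (@cst0 _ lam0) => w; exact: sadmm_lam0 (iterates w).
have [su sz sv sp sl] := IH (fun k i kn => mx k i (ltnW kn)).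
have ss := s_measurable sv sl.
have sv' := v_measurable (fun i => mx n i (ltnSn n)) sv sl.
have su' : separably_measurable (u n.+1).
  rewrite (_ : u n.+1 = fun w => (1 - (theta n)^-1) *: u n w + (theta n)^-1 *: v n.+1 w).
    by apply: separably_measurableD; exact: separably_measurableZ.
  by apply/funext => w; exact: sadmm_u (iterates w) n.
have sz' : separably_measurable (z n.+1).
  rewrite (_ : z n.+1 = fun w => (1 - (theta n)^-1) *: z n w + (theta n)^-1 *: s n.+1 w).
    by apply: separably_measurableD; exact: separably_measurableZ.
  by apply/funext => w; exact: sadmm_z (iterates w) n.
have sp' : separably_measurable (psi n.+1).
  rewrite (_ : psi n.+1 = fun w => psi n w - (mu * rho n) *: (v n.+1 w - s n.+1 w)).
    apply: separably_measurableB => //; apply: separably_measurableZ.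
    exact: separably_measurableB.
  by apply/funext => w; exact: sadmm_psi (iterates w) n.
split=> //.
rewrite (_ : lam n.+1 = fun w =>
    psi n.+1 w - (mu * rho n * theta n) *: (u n.+1 w - z n.+1 w)).
  apply: separably_measurableB => //; apply: separably_measurableZ.
  exact: separably_measurableB.
by apply/funext => w; exact: sadmm_lam (iterates w) n.
Qed.

End iterates_measurable.

Lemma gradient_ineq_convex (R : realType) (U : normedModType R)
    (dot : {dot U for idfun}) (f : U -> R) (grad : U -> U) :
  (forall u v, f u + dot (grad u) (v - u) <= f v) ->
  forall u v t, 0 <= t <= 1 ->
    f (t *: u + (1 - t) *: v) <= t * f u + (1 - t) * f v.
Proof.
move=> h u v t /andP[t0 t1]; set w := _ + _.
have t1' : 0 <= 1 - t by rewrite subr_ge0.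
have := lerD (ler_wpM2l t0 (h w u)) (ler_wpM2l t1' (h w v)).
apply: le_trans; rewrite !(dotBr dot).
have -> : dot (grad w) w = t * dot (grad w) u + (1 - t) * dot (grad w) v.
  by rewrite {2}/w (dotDr dot) !(dotZr dot).
by rewrite le_eqVlt; apply/orP; left; apply/eqP; ring.
Qed.

Lemma lipschitz_continuous (R : realType) (U : normedModType R) (h : U -> U) (L : R) :
  0 <= L -> (forall u v, `|h u - h v| <= L * `|u - v|) -> continuous h.
Proof.
move=> L0 hL u; apply/cvgrPdist_le => e e0.
have L1 : 0 < L + 1 by rewrite ltr_wpDl.
near=> v; apply: le_trans (hL _ _) _.
apply: (@le_trans _ _ ((L + 1) * `|u - v|)); first by rewrite ler_wpM2r// lerDl.
rewrite mulrC -ler_pdivlMr//.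
by near: v; apply: cvgr_dist_le => //; rewrite divr_gt0.
Unshelve. all: by end_near. Qed.

Lemma continuous_EFin_lower_semicontinuous (R : realType) (U : normedModType R)
    (f : U -> R) : continuous (f : U -> R^o) -> lower_semicontinuous (EFin \o f).
Proof.
move=> cf x a; rewrite /= lte_fin => afx.
exists [set y | a < f y]; last by move=> y /=; rewrite lte_fin.
exact: (cvgr_gt (f x : R^o) (cf x) _ afx).
Qed.

Lemma optimal_gap_value (R : realType) (U : normedModType R) (f : U -> R)
    (g : U -> \bar R) (u z : nat -> U) (x : U) (K : nat) :
  g (z K) \is a fin_num -> g x \is a fin_num ->
  ((f (u K))%:E + g (z K) - (f x)%:E - g x)%E = (gap_value f g u z x K)%:E.
Proof.
by move=> gz gx; rewrite /gap_value !EFinB EFinD !fineK.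
Qed.

Lemma kappa_index (R : realType) (L mu rho eta : R) :
  0 <= L * (1 - mu) / (eta * (1 - mu) - rho * mu) ->
  exists N : nat, 2 * sadmm_kappa L mu rho eta = N%:Z /\
    L * (1 - mu) / (eta * (1 - mu) - rho * mu) <= N%:R / 2.
Proof.
rewrite /sadmm_kappa; set a := _ / _ => a0.
have c0 : 0 <= Num.ceil a by rewrite ceil_ge0; apply: lt_le_trans a0.
exists (absz (2 * Num.ceil a)); rewrite gez0_abs ?mulr_ge0//; split=> //.
apply: le_trans (ceil_ge a) _.
by rewrite pmulrn gez0_abs ?mulr_ge0// intrM mulrAC divff ?mul1r.
Qed.

Lemma integral_dominated (d : measure_display) (T : measurableType d)
    (R : realType) (P : probability T R) (h W : T -> R) (a C : R) :
  measurable_fun setT h -> P.-integrable setT (fun w => (W w)%:E) -> 0 <= a ->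
  (forall w, `|h w| <= a * W w) -> (\int[P]_w (W w)%:E <= C%:E)%E ->
  P.-integrable setT (fun w => (h w)%:E) /\ (\int[P]_w (h w)%:E <= (a * C)%:E)%E.
Proof.
move=> mh iW a0 hW WC.
have iaW : P.-integrable setT (fun w => a%:E * (W w)%:E)%E by exact: integrableZl.
have ih : P.-integrable setT (fun w => (h w)%:E).
  apply: le_integrable iaW => //; first exact/measurable_EFinP.
  move=> w _; rewrite -EFinM !abse_EFin lee_fin.
  exact: le_trans (hW w) (ler_norm _).
split=> //; apply: le_trans (le_integral measurableT ih iaW _) _.
  by move=> w _; rewrite -EFinM lee_fin; exact: le_trans (ler_norm _) (hW w).
by rewrite integralZl// EFinM; apply: lee_wpmul2l; rewrite ?lee_fin.
Qed.

Lemma expectation_split (d : measure_display) (T : measurableType d)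
    (R : realType) (P : probability T R) (gap D W : T -> R) (c q C : R) :
  0 < c -> 0 < q -> measurable_fun setT gap -> measurable_fun setT D ->
  P.-integrable setT (fun w => (W w)%:E) -> (\int[P]_w (W w)%:E <= C%:E)%E ->
  (forall w, 0 <= D w) -> (forall w, - (c / 2 * D w) <= gap w) ->
  (forall w, q * gap w + c * (q * D w) <= W w) ->
  (P.-integrable setT (fun w => (gap w)%:E) /\
   (\int[P]_w (gap w)%:E <= (q^-1 * C)%:E)%E) /\
  (P.-integrable setT (fun w => (D w)%:E) /\
   (\int[P]_w (D w)%:E <= (2 / (c * q) * C)%:E)%E).
Proof.
move=> c0 q0 mg mD iW WC D0 glow gup.
have DW w : c * q / 2 * D w <= W w.
  apply: le_trans (gup w); have := ler_wpM2l (ltW q0) (glow w); lra.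
split; apply: (integral_dominated _ iW) => //.
- by rewrite invr_ge0 ltW.
- move=> w; rewrite mulrC ler_pdivlMr// mulrC.
  have := DW w; have := ler_wpM2l (ltW q0) (glow w).
  have := gup w; have : 0 <= c * (q * D w) by rewrite !mulr_ge0// ltW.
  by case: (ger0P (gap w)) => _; lra.
- by rewrite divr_ge0// mulr_ge0// ltW.
- move=> w; rewrite ger0_norm// mulrAC ler_pdivlMr ?mulr_gt0//.
  by have := DW w; lra.
Qed.

Theorem theorem2p7
  (R : realType) (U : completeNormedModType R) (dot : {dot U for idfun})
  (hilbert : norm_from_dot dot)
  (Uad : set U)
  (Uad_nonempty : Uad !=set0) (Uad_closed : closed Uad)
  (Uad_convex : convex_set Uad)
  (Uad_bounded : has_ubound [set `|p.1 - p.2| ^+ 2 | p in Uad `*` Uad])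
  (d : measure_display) (Omega : measurableType d) (P : probability Omega R)
  (n : nat) (Xi : set (n.-tuple (measurableTypeR R)))
  (xi : {mfun Omega >-> n.-tuple (measurableTypeR R)})
  (xi_in_Xi : forall w, Xi (xi w))
  (F : U -> n.-tuple (measurableTypeR R) -> R)
  (gradF : U -> n.-tuple (measurableTypeR R) -> U)
  (F_convex : forall x, Xi x -> convex_function [set: U] (F ^~ x))
  (F_gradient : forall x u, Xi x -> is_gradient dot (F ^~ x) u (gradF u x))
  (gradF_measurable : forall u, strongly_measurable Xi (gradF u))
  (f : U -> R) (gradf : U -> U)
  (F_integrable : forall u, P.-integrable setT (fun w => (F u (xi w))%:E))
  (f_def : forall u, 'E_P[fun w => F u (xi w)]%E = (f u)%:E)
  (f_gradient : forall u, is_gradient dot f u (gradf u))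
  (g : U -> \bar R)
  (g_proper : proper_function g) (g_lsc : lower_semicontinuous g)
  (g_convex : econvex_function g)
  (alpha L varrho : R) (alpha_gt0 : 0 < alpha) (L_ge0 : 0 <= L)
  (f_strongly_convex : forall u v,
     f u + dot (gradf u) (v - u) + alpha / 2 * `|v - u| ^+ 2 <= f v)
  (gradf_lipschitz : forall u v, `|gradf u - gradf v| <= L * `|u - v|)
  (gradF_unbiased : forall u,
     is_bochner_expectation P (fun w => gradF u (xi w)) (gradf u))
  (gradF_variance : forall u,
     ('E_P[fun w => (`|gradF u (xi w) - gradf u| ^+ 2)%R] <= (varrho ^+ 2)%:E)%E)
  (ustar zstar lamstar : U)
  (star_optimal : optimal_solution Uad f g ustar zstar)
  (star_multiplier : optimal_multiplier dot Uad gradf g ustar zstar lamstar)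
  (mu rho eta M : R) (mu_in01 : 0 < mu < 1)
  (rho_gt0 : 0 < rho) (eta_gt0 : 0 < eta)
  (rho_eta_le_alpha : rho + eta <= alpha)
  (eta_gt : rho * mu < eta * (1 - mu))
  (theta : int -> R)
  (thetaN1 : theta (- 1) = 0) (theta0 : theta 0 = 1)
  (thetaS : forall k : nat,
     0 < theta k.+1 /\ theta k.+1 ^+ 2 = theta k ^+ 2 + theta k.+1)
  (m : nat -> nat) (m_gt1 : forall k, (1 < m k)%N)
  (M_gt0 : 0 < M)
  (m_series : series (fun k => (m k)%:R^-1 : R) @ \oo --> M^-1)
  (xis : nat -> nat -> {mfun Omega >-> n.-tuple (measurableTypeR R)})
  (xis_iid : iid_batches P Xi xi m xis)
  (u0 z0 lam0 : U) (u0_in_Uad : Uad u0)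
  (u z v s psi lam : nat -> Omega -> U)
  (iterates : forall w,
     sadmm_iterates dot Uad g gradF mu
       (fun k : nat => rho * theta k) (fun k : nat => eta * theta k)
       (fun k : nat => theta k) m (fun k i => xis k i w)
       u0 z0 lam0
       (u ^~ w) (z ^~ w) (v ^~ w) (s ^~ w) (psi ^~ w) (lam ^~ w))
  (c : R) (c_gt0 : 0 < c) (c_ge : 2 * `|lamstar| <= c)
  (K : nat) (K_ge1 : (1 <= K)%N) :
  let gap := fun w =>
    ((f (u K w))%:E + g (z K w) - (f ustar)%:E - g zstar)%E in
  let C1 :=
    sadmm_C1 theta L mu rho eta varrho M (sqdiameter Uad) c `|lam0| in
  (P.-integrable setT gap /\
   (\int[P]_w gap w <= (C1 / K%:R ^+ 2)%:E)%E) /\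
  (P.-integrable setT (fun w => `|u K w - z K w|%:E) /\
   ('E_P[fun w => `|u K w - z K w|%R] <= (2 * C1 / (c * K%:R ^+ 2))%:E)%E).
Proof.
move=> gap C1.
have [Uad_star zE gzfin _] := star_optimal.
have gx : g ustar \is a fin_num by rewrite zE.
rewrite -zE in star_multiplier.
have [/andP[mu0 mu1] mu1'] : 0 < mu < 1 /\ 0 < 1 - mu.
  by split=> //; case/andP: mu_in01 => _; rewrite subr_gt0.
pose th (k : nat) : R := theta k.
have th0 : th 0%N = 1 by [].
have thS k : 0 < th k.+1 /\ th k.+1 ^+ 2 = th k ^+ 2 + th k.+1 by exact: thetaS.
have th_gt0 k : 0 < th k by apply: lt_le_trans (theta_ge1 th0 thS k).
pose nu := sqdiameter Uad.
have Uad_nu x y : Uad x -> Uad y -> `|x - y| ^+ 2 <= nu.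
  by move=> Ux Uy; apply: (ub_le_sup Uad_bounded); exists (x, y).
have nu0 : 0 <= nu by apply: le_trans (Uad_nu _ _ u0_in_Uad u0_in_Uad); rewrite sqr_ge0.
have f_grad_ineq a b : f a + dot (gradf a) (b - a) <= f b.
  apply: le_trans (f_strongly_convex a b); rewrite lerDl.
  by apply: mulr_ge0 (sqr_ge0 _); rewrite divr_ge0// ltW.
have f_convex := gradient_ineq_convex f_grad_ineq.
have f_descent := descent_lemma hilbert L_ge0 f_grad_ineq gradf_lipschitz.
have cf : continuous (f : U -> R^o).
  by move=> y; apply: differentiable_continuous; case: (f_gradient y).
have cgradf := lipschitz_continuous L_ge0 gradf_lipschitz.
have cgradF t : Xi t -> continuous (gradF ^~ t).
  move=> Xt; apply: (convex_gradient_continuous hilbert (F_convex t Xt)) => y.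
  exact: F_gradient.
have var y : (\int[P]_w (`|gradF y (xi w) - gradf y| ^+ 2)%:E <= (varrho ^+ 2)%:E)%E.
  by have := gradF_variance y; rewrite unlock.
have emu0 : 0 < eta * (1 - mu) - rho * mu by rewrite subr_gt0.
have [N [NE Nge]] := kappa_index (divr_ge0 (mulr_ge0 L_ge0 (ltW mu1')) (ltW emu0)).
pose phi := sadmm_phi L mu rho eta (th N).
have [phi0 phi1 phi2] := phi_bounds th0 thS L_ge0 mu_in01 eta_gt Nge.
rewrite -/phi in phi0 phi1 phi2.
have C1E : C1 = 2 * varrho ^+ 2 * phi / M + 2 * L * nu * theta_sq_pred th N
    + 4 * (c ^+ 2 + `|lam0| ^+ 2) / (mu * rho).
  rewrite /C1 /sadmm_C1 NE -/phi; congr (_ + _ * _ + _).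
  case: N {NE Nge phi phi0 phi1 phi2} => [|N] /=; first by rewrite sub0r thetaN1 expr0n.
  by rewrite -addn1 PoszD addrK.
have iter w := iterates w.
have [xsXi _ _] := xis_iid.
have rth k : 0 < rho * th k by exact: mulr_gt0.
have eth k : 0 < eta * th k by exact: mulr_gt0.
have measO k : [/\ separably_measurable (u k), separably_measurable (z k),
      separably_measurable (v k), separably_measurable (psi k)
    & separably_measurable (lam k)].
  apply: (iterates_measurable hilbert Uad_convex g_proper g_convex
    gradF_measurable cgradF rth eth _ iterates) => // l i w; exact: xsXi.
have measG k j : separably_measurable (v k : g_sigma_algebraType (other_samples m xis k j) -> U).
  have mx l i : (l < k)%N -> (i < m l)%N ->
      measurable_fun setT (xis l i : g_sigma_algebraType (other_samples m xis k j) -> _).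
    move=> lk im; apply: other_samples_measurable => //.
    by apply/eqP => -[lE _]; rewrite lE ltnn in lk.
  by have [] := @iterates_measurable _ _ _ hilbert _ _
    (g_sigma_algebraType (other_samples m xis k j)) _ _ _ _ _ Uad_convex g_proper g_convex
    gradF_measurable cgradF _ _ _ _ _ rth eth (fun k i w => xis k i w) u0 z0 lam0
    (fun l i w => xsXi l i w) u z v s psi lam iterates k mx.
have gz w : g (z K w) \is a fin_num.
  move: K_ge1; case: (K) => // k _.
  exact: (z_convex_comb hilbert g_proper g_convex th0 thS (iter w) k).1.
pose nz k w := noise dot gradf gradF th m (fun k i => xis k i w) (v ^~ w) ustar phi k.
have nzE k : P.-integrable setT (fun w => (nz k w)%:E) /\
    (\int[P]_w (nz k w)%:E <= (phi * varrho ^+ 2 / (2 * (m k)%:R))%:E)%E.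
  have Vnu w : `|v k w - ustar| ^+ 2 <= nu.
    by apply: Uad_nu => //; exact: v_in_Uad u0_in_Uad (iter w) k.
  have [_ _ sv _ _] := measO k.
  exact: (noise_expectation hilbert xi_in_Xi gradF_measurable cgradF cgradf
    gradF_unbiased var xis_iid (th k) (ltnW (m_gt1 k)) phi0 sv (fun j _ => measG k j) Vnu).
pose C0 := (c ^+ 2 + `|lam0| ^+ 2) / (2 * (mu * rho)) + L / 2 * nu * theta_sq_pred th N.
pose W w := C0 + \sum_(k < K) nz k w.
have path w : theta_sq_pred th K * gap_value f g (u ^~ w) (z ^~ w) ustar K
    + c * (theta_sq_pred th K * `|u K w - z K w|) <= W w.
  exact: (pathwise_bound hilbert Uad_convex Uad_nu f_strongly_convex f_convex
    f_descent g_proper g_convex L_ge0 mu_in01 rho_gt0 eta_gt0 rho_eta_le_alpha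
    th0 thS u0_in_Uad (iter w) Uad_star gx phi0 phi1 phi2 K (ltW c_gt0)).
have lower w : - (c / 2 * `|u K w - z K w|) <= gap_value f g (u ^~ w) (z ^~ w) ustar K.
  apply: le_trans (gap_value_ge hilbert Uad_convex f_strongly_convex th0 thS
    u0_in_Uad (iter w) gx star_multiplier (gz w) (ltW alpha_gt0)).
  by rewrite lerN2 ler_wpM2r// ler_pdivlMr// mulrC.
have iW : P.-integrable setT (fun w => (W w)%:E).
  rewrite (_ : (fun _ => _) = (fun w => C0%:E + \sum_(k < K) (nz k w)%:E)%E).
    apply: integrableD => //; first exact: finite_measure_integrable_cst.
    by apply: integrable_sum => // k _; exact: (nzE k).1.
  by apply/funext => w; rewrite sumEFin -EFinD.
have EW : (\int[P]_w (W w)%:E <= (C1 / 4)%:E)%E.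
  rewrite (eq_integral (fun w => C0%:E + \sum_(k < K) (nz k w)%:E)%E); last first.
    by move=> w _; rewrite sumEFin -EFinD.
  rewrite integralD//; last 2 first.
  - exact: finite_measure_integrable_cst.
  - by apply: integrable_sum => // k _; exact: (nzE k).1.
  rewrite integral_cst// [X in (_ * X)%E]probability_setT mule1.
  rewrite integral_sum//; last by move=> k; exact: (nzE k).1.
  apply: (@le_trans _ _ (C0%:E + \sum_(k < K) (phi * varrho ^+ 2 / (2 * (m k)%:R))%:E)%E).
    by apply: leeD2l; apply: lee_sum => k _; exact: (nzE k).2.
  rewrite sumEFin -EFinD lee_fin.
  have -> : \sum_(k < K) phi * varrho ^+ 2 / (2 * (m k)%:R) =
      phi * varrho ^+ 2 / 2 * \sum_(k < K) (m k)%:R^-1.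
    by rewrite big_distrr /=; apply: eq_bigr => k _; rewrite invfM mulrA.
  have -> : C1 / 4 = C0 + phi * varrho ^+ 2 / 2 * M^-1
      + (c ^+ 2 + `|lam0| ^+ 2) / (2 * (mu * rho)).
    by rewrite C1E /C0; field; rewrite !gt_eqF.
  apply: ler_wpDr.
    apply: divr_ge0; first exact: addr_ge0 (sqr_ge0 _) (sqr_ge0 _).
    exact: mulr_ge0 (ler0n _ 2) (mulr_ge0 (ltW mu0) (ltW rho_gt0)).
  rewrite lerD2l; apply: ler_wpM2l.
    exact: divr_ge0 (mulr_ge0 (ltW phi0) (sqr_ge0 _)) (ler0n _ 2).
  have mono : {homo series (fun k => (m k)%:R^-1 : R) : a b / (a <= b)%N >-> a <= b}.
    by apply/nondecreasing_seqP => k; rewrite seriesSr lerDl invr_ge0.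
  have cv : cvgn (series (fun k => (m k)%:R^-1 : R)) by apply/cvg_ex; exists M^-1.
  have := nondecreasing_cvgn_le mono cv K.
  by rewrite (cvg_lim _ m_series)// seriesEnat /= big_mkord; apply.
have q0 : 0 < theta_sq_pred th K.
  apply: lt_le_trans (theta_sq_pred_ge th0 thS K_ge1).
  by rewrite divr_gt0// exprn_gt0// ltr0n.
have gapE w : gap w = (gap_value f g (u ^~ w) (z ^~ w) ustar K)%:E.
  by rewrite /gap -zE; exact: optimal_gap_value (gz w) gx.
have [su sz _ _ _] := measO K.
have mgap : measurable_fun setT (fun w => gap_value f g (u ^~ w) (z ^~ w) ustar K).
  apply/measurable_EFinP.
  rewrite (_ : EFin \o _ = (fun w => (f (u K w))%:E + g (z K w) +
      (- f ustar - fine (g ustar))%:E)%E).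
    apply: emeasurable_funD => //; apply: emeasurable_funD.
      exact: (lower_semicontinuous_comp_measurable
        (continuous_EFin_lower_semicontinuous cf) su).
    exact: (lower_semicontinuous_comp_measurable g_lsc sz).
  apply/funext => w; rewrite /= /gap_value -(fineK (gz w)) -!EFinD; congr (_%:E).
  by rewrite /= !addrA.
have mD : measurable_fun setT (fun w => `|u K w - z K w|).
  by apply: separably_measurable_norm; exact: separably_measurableB.
have [[ig Eg] [iD ED]] := expectation_split c_gt0 q0 mgap mD iW EW
  (fun w => normr_ge0 _) lower path.
have C1_ge0 : 0 <= C1 / 4.
  rewrite -lee_fin; apply: le_trans EW; apply: integral_ge0 => w _; rewrite lee_fin.
  apply: le_trans (path w); have := ler_wpM2l (ltW q0) (lower w).
  have : 0 <= c * (theta_sq_pred th K * `|u K w - z K w|) by rewrite !mulr_ge0// ltW.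
  lra.
have K0 : 0 < K%:R ^+ 2 :> R by rewrite exprn_gt0// ltr0n.
have qV : (theta_sq_pred th K)^-1 <= 4 / K%:R ^+ 2.
  rewrite -[leRHS]invrK invf_div lef_pV2 ?posrE ?divr_gt0//.
  exact: theta_sq_pred_ge.
split; split.
- by rewrite (_ : gap = fun w => (gap_value f g (u ^~ w) (z ^~ w) ustar K)%:E)//; exact/funext.
- rewrite (eq_integral _ _ (fun w _ => gapE w)).
  apply: le_trans Eg _; rewrite lee_fin.
  apply: le_trans (ler_wpM2r C1_ge0 qV) _.
  by rewrite le_eqVlt; apply/orP; left; apply/eqP; field; rewrite gt_eqF// ltr0n.
- exact: iD.
- rewrite unlock; apply: le_trans ED _; rewrite lee_fin.
  have -> : 2 / (c * theta_sq_pred th K) * (C1 / 4) =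
      2 / c * ((theta_sq_pred th K)^-1 * (C1 / 4)) by field; rewrite !gt_eqF.
  have -> : 2 * C1 / (c * K%:R ^+ 2) = 2 / c * (4 / K%:R ^+ 2 * (C1 / 4)).
    by field; rewrite !gt_eqF// ltr0n.
  by apply: ler_wpM2l; [rewrite divr_ge0// ltW|exact: ler_wpM2r].
Qed.
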